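(* For every finite $n$-dimensional simplicial complex $K$, $n>0$, every $p\in\{0,\ldots,n-1\}$ and every $\nu\in[0,1]$, $$\mathbb{E}_\nu(b_p(K_0^\epsilon))-b_p(K)\leq\mathbb{E}_\nu(b_p(V_\epsilon))\leq\mathbb{E}_\nu(b_p(K_0^\epsilon))+b_{p+1}(K).$$ In particular, $$\lim_{d\to+\infty}\frac{\mathbb{E}_{\nu,d}(b_p(K_0^\epsilon))}{f_n(K)\,(n+1)!^d}=e_{p,\nu}(n,1).$$
   Context: $b_p(X)=\dim H_p(X;\mathbb{Z}/2\mathbb{Z})$; $f_n(K)$ is the number of $n$-simplices of $K$; $\mathrm{Sd}^d(K)$ is the $d$-th iterated barycentric subdivision of $K$. A $q$-simplex of $\mathrm{Sd}(K)$ is written $[\hat\sigma_0,\ldots,\hat\sigma_q]$, where $\hat\sigma_i$ is the barycenter of a simplex $\sigma_i$ of $K$ and $\sigma_i$ is a proper face of $\sigma_{i+1}$. $\overline{D}(\sigma)$ is the union of all closed simplices $[\hat\sigma_0,\ldots,\hat\sigma_q]$ of $\mathrm{Sd}(K)$ with $\sigma_0=\sigma$. For $\epsilon\in C^0(K;\mathbb{Z}/2\mathbb{Z})$ (a $\mathbb{Z}/2\mathbb{Z}$-valued function on the vertices of $K$): $K_0^\epsilon$ is the subcomplex of $K$ consisting of the simplices on whose vertices $\epsilon$ is constant; $V_\epsilon$ is the subcomplex of $\mathrm{Sd}(K)$ which is the union of the $\overline{D}(\sigma)$ over the edges ($1$-simplices) $\sigma$ of $K$ on which $\epsilon$ is not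 constant. $\mu_\nu$ is the product probability measure on $C^0(K;\mathbb{Z}/2\mathbb{Z})$ for which the values of $\epsilon$ at the vertices are independent, each being $0$ with probability $\nu$ and $1$ with probability $1-\nu$; $\mathbb{E}_\nu$ is the expectation with respect to $\mu_\nu$. For $d\geq 0$, $\mathbb{E}_{\nu,d}$ denotes the same expectation after replacing $K$ by $\mathrm{Sd}^d(K)$: thus $$\mathbb{E}_{\nu,d}(b_p(K_0^\epsilon))=\int_{C^0(\mathrm{Sd}^d(K);\mathbb{Z}/2\mathbb{Z})}b_p(\mathrm{Sd}^d(K)_0^\epsilon)\,d\mu_\nu(\epsilon),\qquad \mathbb{E}_{\nu,d}(b_p)=\int_{C^0(\mathrm{Sd}^d(K);\mathbb{Z}/2\mathbb{Z})}b_p(V_\epsilon)\,d\mu_\nu(\epsilon),$$ where in the latter $V_\epsilon\subset\mathrm{Sd}^{d+1}(K)$. $e_{p,\nu}(n,1)=\lim_{d\to+\infty}\frac{\mathbb{E}_{\nu,d}(b_p)}{f_n(K)(n+1)!^d}$, a limit which exists and is independent of the finite $n$-dimensional complex $K$. *)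

(* Defs.v *)
From HB Require Import structures.
From mathcomp Require Import all_boot all_order all_algebra.
From mathcomp Require Import all_classical all_reals all_analysis.
Set Implicit Arguments.
Unset Strict Implicit.
Unset Printing Implicit Defensive.
Import Order.TTheory GRing.Theory Num.Theory.
Import numFieldNormedType.Exports.
Local Open Scope ring_scope.

(* Finite simplicial complexes are abstract: a simplex is its nonempty set of
   vertices, and every element of the type [vertex] is a vertex of the complex,
   so that functions on [vertex] are exactly the 0-cochains. *)
Record simplicial_complex := SimplicialComplex {
  vertex : finType;
  simplices : {set {set vertex}};
  simplices_neq0 : forall s, s \in simplices -> s != finset.set0;
  simplices_face : forall s t : {set vertex},
    s \in simplices -> t != finset.set0 -> t \subset s -> t \in simplices;
  simplices_vertex : forall v : vertex, [set v]%SET \in simplices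
}.

(* Families of sets that are not bundled as a [simplicial_complex], such as the
   subcomplexes of a given complex, also have simplices and Betti numbers; the
   [simplices_of_card k] are the simplices of dimension k - 1. *)
Definition simplices_of_card (T : finType) (X : {set {set T}}) (k : nat) :
  {set {set T}} := [set s in X | #|s| == k]%SET.

Definition f_vector (K : simplicial_complex) (n : nat) : nat :=
  #|simplices_of_card (simplices K) n.+1|.

(* The value on the empty complex is 0 rather than -1. *)
Definition dimension (K : simplicial_complex) : nat :=
  \max_(s in simplices K) #|s|.-1.

(* The matrix, acting on row vectors, of the boundary map from p-chains to
   (p-1)-chains; no signs are needed modulo 2. For p = 0 it has no columns as
   soon as the empty set is not in X, which gives unreduced homology. *)
Definition boundary (T : finType) (X : {set {set T}}) (p : nat) :
  'M['F_2]_(#|simplices_of_card X p.+1|, #|simplices_of_card X p|) :=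
  \matrix_(i, j)
    ((enum_val j : {set T}) \subset (enum_val i : {set T}))%:R.

(* dim H_p = dim Z_p - dim B_p; B_p is contained in Z_p when X is closed under
   nonempty faces, so the subtraction is not truncated. *)
Definition betti (T : finType) (X : {set {set T}}) (p : nat) : nat :=
  (\rank (kermx (boundary X p)) - \rank (boundary X p.+1))%N.

Section Subdivision.
Variable K : simplicial_complex.

(* The simplex s of K stands for its barycenter. *)
Definition barycenter : finType := {s : {set vertex K} | s \in simplices K}.

Definition is_flag (c : {set barycenter}) : bool :=
  [forall a in c, forall b in c, (val a \subset val b) || (val b \subset val a)].

Definition Sd_simplices : {set {set barycenter}} :=
  [set c | (c != finset.set0) && is_flag c]%SET.

Lemma Sd_simplices_neq0 c : c \in Sd_simplices -> c != finset.set0.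
Proof. by rewrite inE => /andP[]. Qed.

Lemma Sd_simplices_face (c e : {set barycenter}) :
  c \in Sd_simplices -> e != finset.set0 -> e \subset c -> e \in Sd_simplices.
Proof.
rewrite !inE => /andP[_ /forall_inP flc] -> /fintype.subsetP ec /=.
apply/forall_inP => a ae; apply/forall_inP => b be.
by have /forall_inP := flc a (ec a ae); apply; apply: ec.
Qed.

Lemma Sd_simplices_vertex (a : barycenter) : [set a]%SET \in Sd_simplices.
Proof.
rewrite inE; apply/andP; split; first by apply/set0Pn; exists a; rewrite inE.
apply/forall_inP => b /finset.set1P ->; apply/forall_inP => e /finset.set1P ->.
by rewrite fintype.subxx.
Qed.

Definition Sd : simplicial_complex :=
  SimplicialComplex Sd_simplices_neq0 Sd_simplices_face Sd_simplices_vertex.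

(* The closed block D(s), as a subcomplex of Sd K: the faces of the flags whose
   smallest element is s. *)
Definition dual_block (s : vertex Sd) : {set {set vertex Sd}} :=
  [set t in simplices Sd |
    [exists c in simplices Sd,
      [&& t \subset c, s \in c & [forall a in c, val s \subset val a]]]]%SET.

Definition cochain0 : finType := {ffun vertex K -> 'F_2}.

Definition constant_on (eps : cochain0) (s : {set vertex K}) : bool :=
  [forall x in s, forall y in s, eps x == eps y].

Definition K0 (eps : cochain0) : {set {set vertex K}} :=
  [set s in simplices K | constant_on eps s]%SET.

Definition V (eps : cochain0) : {set {set vertex Sd}} :=
  (\bigcup_(s : vertex Sd | (#|val s| == 2)%N && ~~ constant_on eps (val s))
     dual_block s)%SET.

End Subdivision.

Section Expectation.
Variables (R : realType) (nu : R).

Definition mu (K : simplicial_complex) (eps : cochain0 K) : R :=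
  \prod_(v : vertex K) (if eps v == 0 then nu else 1 - nu).

Definition expectation (K : simplicial_complex) (X : cochain0 K -> R) : R :=
  \sum_(eps : cochain0 K) X eps * mu eps.

Definition E_betti_K0 (p : nat) (K : simplicial_complex) : R :=
  expectation (fun eps : cochain0 K => (betti (K0 eps) p)%:R).

Definition E_betti_V (p : nat) (K : simplicial_complex) : R :=
  expectation (fun eps : cochain0 K => (betti (V eps) p)%:R).

(* The number e_(p,nu)(n,1): the common limit for all finite complexes of
   dimension n. [get] picks a number with this property, which is unique as
   limits are; it would be unspecified if there were none. *)
Definition e_limit (p n : nat) : R :=
  get (fun e : R => forall K : simplicial_complex, dimension K = n ->
    (E_betti_V p (iter d Sd K) / ((f_vector K n)%:R * (n.+1)`!%:R ^+ d)
      @[d --> \oo] --> e)%classic).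

End Expectation.

(* Main.v *)
Require Import Defs.
From HB Require Import structures.
From mathcomp Require Import all_boot all_order all_algebra.
From mathcomp Require Import zify.
Set Implicit Arguments.
Unset Strict Implicit.
Unset Printing Implicit Defensive.
Import GRing.Theory.
Local Open Scope ring_scope.

(** Let [K] carry a cochain [eps]. The complex [V eps] consists of the flags of
    simplices on which [eps] is not constant ([mem_V]). Such a simplex is the
    join of its two faces on which [eps] is 0 and 1, and [V eps] cuts it along
    the product of these faces, so that [K] minus [K0 eps] is the product of
    [V eps] with an open interval. Hence H_p(V) is H_(p+1)(K, K0): this is
    [betti_V], with [K] subdivided. The exact sequence of the pair bounds the
    difference of [betti (V eps) p] and [betti (K0 eps) p] by Betti numbers of
    [K], for every [eps] ([betti_K0_le], [betti_V_le]), and the first claim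
    follows by averaging.

    Subdividing [K] does not change its Betti numbers ([betti_Sd]). So the
    inequalities for the [d]-th subdivision have error terms that do not depend
    on [d], and it remains to see that the expected Betti numbers of [V] have a
    limit, after division by [f_n(K) (n+1)!^d], which is the same for all [K].
    Cut [V] along the subdivided (n-1)-skeleton of [K]. This changes its Betti
    numbers by at most the number of simplices of that skeleton
    ([betti_V_pieces]), which is O((n! + 1/2)^d) ([skeleton_card_le]). What is
    left is a disjoint union of one piece for each n-simplex, and all the pieces
    have the same expected Betti number x_d, because the restriction of [eps] to
    the vertices of one subdivided simplex follows the product law ([sum_marginal]).
    Therefore the expectation is f_n(K) x_d + O((n! + 1/2)^d)
    ([E_betti_V_asymptotics]). Comparing the subdivision d+1 of [K] with the
    subdivision d of [Sd K], which has (n+1)! f_n(K) simplices of dimension n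
    ([f_vector_Sd]), shows that x_(d+1) = (n+1)! x_d + O((n! + 1/2)^d)
    ([interior_increment]); so x_d / (n+1)!^d converges, and its limit is the
    one sought.

    Homology enters through ranks only. A family of finite sets that is convex,
    that is, a difference of two simplicial complexes, has a chain complex
    modulo 2 whose matrices are incidence matrices, and the exactness of the
    long sequence of a pair gives three inequalities between Betti numbers
    ([betti_total_le], [betti_sub_le], [betti_quotient_le]). Equalities of Betti
    numbers come from these by exhibiting acyclic families, and a family is
    acyclic when its sets can be matched in pairs that make the incidence matrix
    triangular ([toggle_acyclic]). *)

(** * Ranks of blocks of a matrix *)

Section MaskedMatrices.
Variables (F : fieldType) (I : finType).
Implicit Types (A B C Q Z : {set I}) (D : 'M[F]_#|I|).

(** Cutting out blocks by diagonal projections keeps all the matrices square, of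
    one size; [rank_mask] returns to the submatrices. *)
Definition mask A : 'M[F]_#|I| :=
  diag_mx (\row_i (enum_val i \in A)%:R).

Definition selection A : 'M[F]_(#|A|, #|I|) :=
  \matrix_(i, j) (enum_val i == enum_val j)%:R.

Lemma maskI A B : mask A *m mask B = mask (A :&: B).
Proof.
rewrite mulmx_diag; congr diag_mx; apply/rowP => i; rewrite !mxE inE.
by case: (_ \in A); rewrite ?mul1r ?mul0r.
Qed.

Lemma maskU A B : [disjoint A & B] -> mask (A :|: B) = mask A + mask B.
Proof.
move=> dAB; rewrite -raddfD /=; congr diag_mx; apply/rowP => i; rewrite !mxE inE.
have [iA|_] := boolP (enum_val i \in A); last by rewrite add0r.
by rewrite (disjointFr dAB iA) addr0.
Qed.

Lemma mask0 : mask set0 = 0.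
Proof. by apply/matrixP => i j; rewrite !mxE inE mul0rn. Qed.

Lemma mask_disjoint A B : [disjoint A & B] -> mask A *m mask B = 0.
Proof. by rewrite maskI -setI_eq0 => /eqP ->; exact: mask0. Qed.

Lemma tr_mask A : (mask A)^T = mask A.
Proof. exact: tr_diag_mx. Qed.

Lemma tr_selection_mul A : (selection A)^T *m selection A = mask A.
Proof.
apply/matrixP => i j; rewrite !mxE.
under eq_bigr do rewrite !mxE -natrM mulnb.
rewrite -(big_enum_val (A := mem A)
  (fun x => ((x == enum_val i) && (x == enum_val j))%:R : F)) /=.
have [iA|iNA] := boolP (enum_val i \in A).
  rewrite (bigD1 (enum_val i)) //= big1 ?addr0; last first.
    by move=> x /andP[_ /negbTE ->].
  by rewrite eqxx (inj_eq enum_val_inj); case: eqP.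
rewrite mul0rn big1 // => x xA.
by case: eqP => // xi; rewrite -xi xA in iNA.
Qed.

Lemma selection_mul_tr A : selection A *m (selection A)^T = 1%:M.
Proof.
apply/matrixP => i j; rewrite !mxE.
rewrite (bigD1 (enum_rank (enum_val i))) //= big1 ?addr0; last first.
  move=> k /negP ki; rewrite !mxE.
  case: eqP => [e|]; last by rewrite mul0r.
  by case: ki; rewrite e enum_valK.
by rewrite !mxE enum_rankK eqxx mul1r (inj_eq enum_val_inj) eq_sym.
Qed.

Lemma rank_mask A B D :
  \rank (selection A *m D *m (selection B)^T) = \rank (mask A *m D *m mask B).
Proof.
apply/eqP; rewrite eqn_leq; apply/andP; split.
  have -> : selection A *m D *m (selection B)^T
      = selection A *m (mask A *m D *m mask B) *m (selection B)^T.
    rewrite -!tr_selection_mul !mulmxA selection_mul_tr mul1mx -!mulmxA.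
    by rewrite selection_mul_tr mulmx1.
  by apply: leq_trans (mxrankM_maxl _ _) _; apply: mxrankM_maxr.
rewrite -!tr_selection_mul -!mulmxA.
apply: leq_trans (mxrankM_maxr _ _) _.
by rewrite !mulmxA; apply: mxrankM_maxl.
Qed.

Lemma rank_block_triangular A1 A2 B1 B2 D :
  [disjoint A1 & A2] -> [disjoint B1 & B2] -> mask A1 *m D *m mask B2 = 0 ->
  (\rank (mask A1 *m D *m mask B1) + \rank (mask A2 *m D *m mask B2)
    <= \rank (mask (A1 :|: A2) *m D *m mask (B1 :|: B2)))%N.
Proof.
move=> dA dB D0; set U := mask (_ :|: _) *m _ *m _.
have A1U : mask A1 *m U = mask A1 *m D *m mask B1.
  by rewrite /U !mulmxA maskI setUC setKU (maskU dB) mulmxDr D0 addr0.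
have UB2 : U *m mask B2 = mask A2 *m D *m mask B2.
  rewrite /U -!mulmxA maskI (setUC B1) setUK (maskU dA) !mulmxA !mulmxDl.
  by rewrite D0 add0r.
rewrite -(mxrank_mul_ker U (mask B2)) UB2 addnC leq_add2l.
apply: mxrankS; rewrite sub_capmx -{1}A1U submxMl sub_kermx.
by rewrite -mulmxA (mask_disjoint dB) mulmx0 eqxx.
Qed.

(** Modulo the rows indexed by [C], multiplication by the [P]-[Q] block kills the
    rows indexed by [Q]; so the rank of this block and the rank of these rows
    modulo [C] add up to at most the number of rows. *)
Lemma rank_exact P C Q Z D :
  [disjoint C & Q] ->
  mask P *m D *m mask (C :|: Q) *m D *m mask Z = 0 ->
  (\rank (mask (C :|: Q) *m D *m mask Z) + \rank (mask P *m D *m mask Q)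
    <= \rank (mask C *m D *m mask Z) + #|Q|)%N.
Proof.
move=> dCQ; rewrite maskU // mulmxDr !mulmxDl => DD0.
set a := mask C *m D *m mask Z; set b := mask Q *m D *m mask Z.
have rk_ab : (\rank (a + b)%R <= \rank (b *m cokermx a) + \rank a)%N.
  rewrite -(mxrank_mul_ker (a + b) (cokermx a)) mulmxDl mulmx_coker add0r.
  rewrite leq_add2l mxrankS //; apply: submx_trans (capmxSr _ _) _.
  by rewrite submxE mulmx_ker.
move: (cokermx a) (mulmx_coker a) rk_ab => w aw0 rk_ab.
have /mulmx0_rank_max PQ0 : (mask P *m D *m (selection Q)^T)
    *m (selection Q *m D *m mask Z *m w) = 0.
  rewrite !mulmxA -(mulmxA _ _ (selection Q)) tr_selection_mul.
  have := congr1 (mulmx^~ (w)) DD0.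
  rewrite /= mul0mx mulmxDl.
  have -> : mask P *m D *m mask C *m D *m mask Z *m w
     = mask P *m D *m (a *m w)
    by rewrite /a !mulmxA.
  by rewrite aw0 mulmx0 add0r.
have le1 : (\rank (b *m w)
    <= \rank (selection Q *m D *m mask Z *m w))%N.
  have -> : b *m w
    = (selection Q)^T *m (selection Q *m D *m mask Z *m w).
    by rewrite !mulmxA tr_selection_mul.
  exact: mxrankM_maxr.
have le2 : (\rank (mask P *m D *m mask Q)
    <= \rank (mask P *m D *m (selection Q)^T))%N.
  by rewrite -(tr_selection_mul Q) mulmxA mxrankM_maxl.
lia.
Qed.

Lemma rank_tr_mask A B D :
  \rank (mask A *m D *m mask B) = \rank (mask B *m D^T *m mask A).
Proof. by rewrite -mxrank_tr !trmx_mul !tr_mask mulmxA. Qed.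

(** The transpose of [rank_exact]. *)
Lemma rank_coexact P C Q Z D :
  [disjoint C & Q] ->
  mask Z *m D *m mask (C :|: Q) *m D *m mask P = 0 ->
  (\rank (mask Z *m D *m mask (C :|: Q)) + \rank (mask C *m D *m mask P)
    <= \rank (mask Z *m D *m mask Q) + #|C|)%N.
Proof.
move=> dCQ /(congr1 trmx); rewrite !trmx_mul !tr_mask trmx0 !mulmxA => DD0.
rewrite setUC in DD0 *; rewrite rank_tr_mask (rank_tr_mask C).
rewrite (rank_tr_mask Z Q); apply: rank_exact => //.
by rewrite disjoint_sym.
Qed.

End MaskedMatrices.

(** * Betti numbers of families of finite sets *)

Lemma rank_reindex_le (F : fieldType) (I J I' J' : finType)
    (A : {set I}) (B : {set J}) (A' : {set I'}) (B' : {set J'})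
    (M : I -> J -> F) (M' : I' -> J' -> F) (h : I -> I') (k : J -> J') :
  {in A, forall a, h a \in A'} -> {in B, forall b, k b \in B'} ->
  {in A & B, forall a b, M a b = M' (h a) (k b)} ->
  (\rank (\matrix_(i < #|A|, j < #|B|) M (enum_val i) (enum_val j))
    <= \rank (\matrix_(i < #|A'|, j < #|B'|) M' (enum_val i) (enum_val j)))%N.
Proof.
move=> hA kB MM'.
pose h' i := enum_rank_in (hA _ (enum_valP i)) (h (enum_val i)).
pose k' j := enum_rank_in (kB _ (enum_valP j)) (k (enum_val j)).
set N := (X in (_ <= \rank X)%N).
have -> : \matrix_(i < #|A|, j < #|B|) M (enum_val i) (enum_val j)
    = mxsub h' k' N.
  apply/matrixP => i j; rewrite !mxE /h' /k' !enum_rankK_in ?hA ?kB ?enum_valP //.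
  by rewrite MM' ?enum_valP.
rewrite mxsubrc; apply: leq_trans (mxrankS (rowsub_sub _ _)) _.
rewrite -mxrank_tr trmx_mxsub.
by apply: leq_trans (mxrankS (rowsub_sub _ _)) _; rewrite mxrank_tr.
Qed.

Section Families.
Variable T : finType.
Implicit Types (A B C Q X : {set {set T}}) (r s t : {set T}).

Definition incidence : 'M['F_2]_#|{set T}| :=
  \matrix_(i, j) ((enum_val j : {set T}) \subset (enum_val i : {set T}))%:R.

Definition incidence_rank A B : nat :=
  \rank (mask 'F_2 A *m incidence *m mask 'F_2 B).

Lemma boundaryE X p :
  boundary X p = selection 'F_2 (simplices_of_card X p.+1) *m incidence
    *m (selection 'F_2 (simplices_of_card X p))^T.
Proof.
have sel1 (B : {set {set T}}) : selection 'F_2 B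
    = rowsub (fun i => enum_rank (enum_val i)) 1%:M.
  apply/matrixP => i j; rewrite !mxE; congr (_%:R).
  by rewrite -(inj_eq enum_val_inj) enum_rankK.
apply/matrixP => i j; rewrite !sel1 mul_rowsub_mx mul1mx.
by rewrite trmx_mxsub trmx1 mulmx_colsub mulmx1 !mxE !enum_rankK.
Qed.

Lemma betti_incidence_rank X p :
  betti X p = (#|simplices_of_card X p.+1|
    - incidence_rank (simplices_of_card X p.+1) (simplices_of_card X p)
    - incidence_rank (simplices_of_card X p.+2) (simplices_of_card X p.+1))%N.
Proof. by rewrite /betti mxrank_ker !boundaryE !rank_mask. Qed.

Lemma mask_block_entry A B (D : 'M['F_2]_#|{set T}|) i j :
  (mask 'F_2 A *m D *m mask 'F_2 B) i j
    = (enum_val i \in A)%:R * D i j * (enum_val j \in B)%:R.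
Proof. by rewrite mul_mx_diag mxE mul_diag_mx !mxE. Qed.

Lemma mask_block_eq0 A B :
  {in A & B, forall s t, ~~ (t \subset s)} ->
  mask 'F_2 A *m incidence *m mask 'F_2 B = 0.
Proof.
move=> AB; apply/matrixP => i j; rewrite mask_block_entry [RHS]mxE.
have [iA|] := boolP (_ \in A); last by rewrite !mul0r.
have [jB|] := boolP (_ \in B); last by rewrite mulr0.
by rewrite mxE (negbTE (AB _ _ iA jB)) mulr0 mul0r.
Qed.

Lemma incidence_rank_mono A A' B B' : A' \subset A -> B' \subset B ->
  (incidence_rank A' B' <= incidence_rank A B)%N.
Proof.
move=> /setIidPl AA' /setIidPr BB'; rewrite /incidence_rank.
rewrite -[A' in X in (X <= _)%N]AA' -[B' in X in (X <= _)%N]BB' -!maskI.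
have -> : mask 'F_2 A' *m mask 'F_2 A *m incidence
      *m (mask 'F_2 B *m mask 'F_2 B')
    = mask 'F_2 A' *m (mask 'F_2 A *m incidence *m mask 'F_2 B)
      *m mask 'F_2 B' by rewrite !mulmxA.
by apply: leq_trans (mxrankM_maxl _ _) _; apply: mxrankM_maxr.
Qed.

(** Subcomplexes are convex, and so are their differences, whose chains form
    a relative chain complex. *)
Definition convex X :=
  forall r s t, r \in X -> t \in X -> r \subset s -> s \subset t -> s \in X.

Lemma card_between s t : t \subset s -> #|s| = #|t|.+2 ->
  #|[set u : {set T} | [&& t \subset u, u \subset s & #|u| == #|t|.+1]]| = 2.
Proof.
move=> ts cs.
have -> : [set u : {set T} | [&& t \subset u, u \subset s & #|u| == #|t|.+1]]
    = [set x |: t | x in s :\: t].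
  apply/setP => u; rewrite inE; apply/and3P/imsetP.
    move=> [tu us /eqP cu].
    have /eqP/cards1P[x ux] : #|u :\: t| = 1%N.
      by have := cardsDS tu; rewrite cu; lia.
    have : x \in u :\: t by rewrite ux inE.
    rewrite inE => /andP[xt xu]; exists x; first by rewrite inE xt (subsetP us).
    by rewrite -(setID u t) ux setUC (setIidPr tu).
  move=> [x /setDP[xs xt] ->]; rewrite subsetUr cardsU1 xt subUset sub1set xs.
  by split.
rewrite card_in_imset; first by have := cardsDS ts; lia.
move=> x y /setDP[_ xt] /setDP[_ yt] /setP/(_ x).
by rewrite !inE eqxx (negbTE xt) !orbF => /esym/eqP.
Qed.

(** Between two nested sets whose cardinals differ by two there are exactly two
    sets, and 2 is 0. *)
Lemma incidence_sq X k : convex X ->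
  mask 'F_2 (simplices_of_card X k.+2) *m incidence
    *m mask 'F_2 (simplices_of_card X k.+1) *m incidence
    *m mask 'F_2 (simplices_of_card X k) = 0.
Proof.
move=> cX; rewrite -2!(mulmxA (mask 'F_2 _ *m incidence)) mulmxA.
rewrite -(mulmxA (mask _ _)).
apply/matrixP => i j; rewrite mask_block_entry [RHS]mxE.
set s : {set T} := enum_val i; set t : {set T} := enum_val j.
have [/setIdP[sX /eqP cs]|] := boolP (s \in _); last by rewrite !mul0r.
have [/setIdP[tX /eqP ct]|] := boolP (t \in _); last by rewrite mulr0.
rewrite mul1r mulr1 mulmxA mul_mx_diag mxE.

under eq_bigr do rewrite !mxE -!natrM !mulnb.
rewrite -(big_enum_val (A := mem {set T}) (fun u : {set T} =>
  (((u \subset s) && (u \in simplices_of_card X k.+1)) && (t \subset u))%:R)) /=.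

rewrite -natr_sum (_ : \sum_(u in {set T}) _ = #|[set u : {set T} |
    [&& t \subset u, u \subset s & u \in simplices_of_card X k.+1]]|)%N; last first.
  rewrite -sum1dep_card big_mkcond [RHS]big_mkcond /=; apply: eq_bigr => u _.
  by rewrite andbC; case: (_ && _).
have [ts|nts] := boolP (t \subset s); last first.
  rewrite (_ : [set u | _] = set0) ?cards0 //; apply/setP => u; rewrite !inE.
  apply/negP => /and3P[tu us _]; case/negP: nts; exact: subset_trans tu us.
rewrite (_ : [set u | _]
    = [set u : {set T} | [&& t \subset u, u \subset s & #|u| == #|t|.+1]]).
  by rewrite card_between // ?cs ?ct //; apply/eqP.
apply/setP => u; rewrite !inE ct; case: (boolP (t \subset u)) => //= tu.
case: (boolP (u \subset s)) => //= us.
by rewrite (cX t u s).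
Qed.


Lemma betti_rank_nullity X p : convex X ->
  (betti X p
    + incidence_rank (simplices_of_card X p.+1) (simplices_of_card X p)
    + incidence_rank (simplices_of_card X p.+2) (simplices_of_card X p.+1)
   = #|simplices_of_card X p.+1|)%N.
Proof.
move=> cX; rewrite betti_incidence_rank.
have := @rank_exact _ _ (simplices_of_card X p.+2) set0
  (simplices_of_card X p.+1) (simplices_of_card X p) incidence.
rewrite set0U incidence_sq // mask0 !mul0mx mxrank0 add0n.
rewrite -/(incidence_rank _ _) -/(incidence_rank _ _) -setI_eq0 set0I.
by move=> /(_ (eqxx _) erefl); lia.
Qed.

Lemma betti_le_card X p : (betti X p <= #|X|)%N.
Proof.
rewrite betti_incidence_rank.
have /subset_leq_card : simplices_of_card X p.+1 \subset X.
  by apply/subsetP => s /setIdP[].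
lia.
Qed.

(** [C] plays the part of a subcomplex of [C :|: Q], and [Q] that of the
    quotient. *)
Definition no_face C Q := {in C & Q, forall s t, ~~ (t \subset s)}.

Section Extension.
Variables C Q : {set {set T}}.
Hypotheses (cX : convex (C :|: Q)) (dCQ : [disjoint C & Q]) (nCQ : no_face C Q).

Lemma convex_sub : convex C.
Proof.
move=> r s t rC tC rs st.
have /setUP[//|sQ] : s \in C :|: Q by apply: (cX _ _ rs st); rewrite inE ?rC ?tC.
by have := nCQ tC sQ; rewrite st.
Qed.

Lemma convex_quotient : convex Q.
Proof.
move=> r s t rQ tQ rs st.
have /setUP[sC|//] : s \in C :|: Q.
  by apply: (cX _ _ rs st); rewrite inE ?rQ ?tQ orbT.
by have := nCQ sC rQ; rewrite rs.
Qed.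

Let cardU k : simplices_of_card (C :|: Q) k
  = simplices_of_card C k :|: simplices_of_card Q k.
Proof. by apply/setP => s; rewrite !inE andb_orl. Qed.

Let dk k l : [disjoint simplices_of_card C k & simplices_of_card Q l].
Proof.
rewrite -setI_eq0; apply/eqP/setP => s; rewrite !inE.
by case: (boolP (s \in C)) => //= sC; rewrite (disjointFr dCQ sC) /= andbF.
Qed.

Let nk k l : mask 'F_2 (simplices_of_card C k) *m incidence
  *m mask 'F_2 (simplices_of_card Q l) = 0.
Proof.
by apply: mask_block_eq0 => s t /setIdP[sC _] /setIdP[tQ _]; apply: nCQ.
Qed.

Let card_k k : (#|simplices_of_card (C :|: Q) k|
  = #|simplices_of_card C k| + #|simplices_of_card Q k|)%N.
Proof. by rewrite cardU cardsU disjoint_setI0 // cards0 subn0. Qed.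

Let rkX k := incidence_rank (simplices_of_card (C :|: Q) k.+1)
  (simplices_of_card (C :|: Q) k).
Let rkC k := incidence_rank (simplices_of_card C k.+1) (simplices_of_card C k).
Let rkQ k := incidence_rank (simplices_of_card Q k.+1) (simplices_of_card Q k).

Let rk_ge k : (rkC k + rkQ k <= rkX k)%N.
Proof. by rewrite /rkX !cardU; exact: rank_block_triangular. Qed.

Let rk_sub k : (rkX k + rkQ k.+1 <= rkC k + #|simplices_of_card Q k.+1|)%N.
Proof.
have -> : rkC k = incidence_rank (simplices_of_card C k.+1)
    (simplices_of_card C k :|: simplices_of_card Q k).
  by rewrite /incidence_rank maskU // mulmxDr nk addr0.
rewrite /rkX !cardU; apply: rank_exact; first exact: dk.
rewrite -!cardU.
have -> : mask 'F_2 (simplices_of_card Q k.+2)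
   = mask 'F_2 (simplices_of_card Q k.+2)
     *m mask 'F_2 (simplices_of_card (C :|: Q) k.+2).
  by rewrite maskI cardU setKU.
have := congr1 (mulmx (mask 'F_2 (simplices_of_card Q k.+2)))
  (incidence_sq k cX).
by rewrite mulmx0 !mulmxA.
Qed.

Let rk_quo k : (rkX k + (if k is l.+1 then rkC l else 0)
  <= rkQ k + #|simplices_of_card C k|)%N.
Proof.
have -> : rkQ k = incidence_rank
    (simplices_of_card C k.+1 :|: simplices_of_card Q k.+1)
    (simplices_of_card Q k).
  by rewrite /incidence_rank (maskU _ (dk _ _)) 2!mulmxDl nk add0r.
have -> : (if k is l.+1 then rkC l else 0)%N = incidence_rank
    (simplices_of_card C k) (if k is l.+1 then simplices_of_card C l else set0).
  by case: k => //; rewrite /incidence_rank mask0 mulmx0 mxrank0.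
rewrite /rkX !cardU; apply: rank_coexact; first exact: dk.
case: k => [|k]; first by rewrite mask0 mulmx0.
rewrite -!cardU.
have CE : mask 'F_2 (simplices_of_card C k)
   = mask 'F_2 (simplices_of_card (C :|: Q) k)
     *m mask 'F_2 (simplices_of_card C k).
  by rewrite maskI cardU setUK.
have := congr1 (mulmx^~ (mask 'F_2 (simplices_of_card C k)))
  (incidence_sq k cX).
by rewrite /= mul0mx -mulmxA -CE.
Qed.

Let ranksX p := betti_rank_nullity p cX.
Let ranksC p := betti_rank_nullity p convex_sub.
Let ranksQ p := betti_rank_nullity p convex_quotient.

(** This and the next two inequalities say that the long sequence of the pair is
    exact at each of its three kinds of terms. *)
Lemma betti_total_le p : (betti (C :|: Q) p <= betti C p + betti Q p)%N.
Proof.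
have := ranksX p; have := ranksC p; have := ranksQ p.
have := rk_ge p; have := rk_ge p.+1; have := card_k p.+1.
rewrite /rkX /rkC /rkQ; lia.
Qed.

Lemma betti_sub_le p : (betti C p <= betti (C :|: Q) p + betti Q p.+1)%N.
Proof.
have := ranksX p; have := ranksC p; have := ranksQ p.+1.
have := rk_sub p; have := rk_sub p.+1; have := card_k p.+1.
rewrite /rkX /rkC /rkQ; lia.
Qed.

Lemma betti_quotient_le p :
  (betti Q p.+1 <= betti (C :|: Q) p.+1 + betti C p)%N.
Proof.
have := ranksX p.+1; have := ranksC p; have := ranksQ p.+1.
have := rk_quo p.+1; have := rk_quo p.+2; have := card_k p.+2.
rewrite /rkX /rkC /rkQ; lia.
Qed.

Lemma betti_quotient_le_card p : (betti Q p <= betti (C :|: Q) p + #|C|)%N.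
Proof.
have /subset_leq_card : simplices_of_card C p \subset C.
  by apply/subsetP => s /setIdP[].
have := ranksX p; have := ranksQ p.
have := rk_quo p; have := rk_quo p.+1; have := card_k p.+1.
rewrite /rkX /rkC /rkQ; lia.
Qed.

Lemma betti_disjoint_union p : no_face Q C ->
  betti (C :|: Q) p = (betti C p + betti Q p)%N.
Proof.
move=> nQC.
have rkD k : rkX k = (rkC k + rkQ k)%N.
  apply/eqP; rewrite eqn_leq rk_ge andbT /rkX /incidence_rank !cardU !maskU //.
  have nk' : mask 'F_2 (simplices_of_card Q k.+1) *m incidence
      *m mask 'F_2 (simplices_of_card C k) = 0.
    by apply: mask_block_eq0 => s t /setIdP[sQ _] /setIdP[tC _]; apply: nQC.
  by rewrite mulmxDr !mulmxDl nk nk' addr0 add0r mxrank_add.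
have := ranksX p; have := ranksC p; have := ranksQ p.
have := rkD p; have := rkD p.+1; have := card_k p.+1.
rewrite /rkX /rkC /rkQ; lia.
Qed.

End Extension.

(** The sets of [X] are matched in pairs that differ by one vertex [v s]. If a face
    of [s] that is matched along another vertex always has a smaller [phi], the
    incidence matrix from the upper sets of the pairs to the lower ones is
    triangular. Hence the rank in each degree is at least the number of lower
    sets, which leaves no homology. *)
Section Toggle.
Variables (X : {set {set T}}) (v : {set T} -> T) (phi : {set T} -> nat).
Hypothesis cX : convex X.
Hypothesis toggle_add : {in X, forall s,
  [/\ v s |: s \in X, v (v s |: s) = v s & phi (v s |: s) = phi s]}.
Hypothesis toggle_remove : {in X, forall s, v s \in s ->
  s :\ v s \in X /\ v (s :\ v s) = v s}.
Hypothesis toggle_phi : {in X &, forall s t,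
  t \subset s -> v t != v s -> (phi t < phi s)%N}.

Let low k := [set s in simplices_of_card X k | v s \notin s].
Let up s := v s |: s.

Let up_inj k : {in low k &, injective up}.
Proof.
move=> s t /setIdP[/setIdP[sX _] vs] /setIdP[/setIdP[tX _] vt] st.
have [_ vS _] := toggle_add sX; have [_ vT _] := toggle_add tX.
have vst : v s = v t by rewrite -vS -vT; congr v.
by rewrite -[LHS](setU1K vs) -[RHS](setU1K vt) -/(up s) st vst.
Qed.

Let low_rank k (A : {set {set T}}) : A \subset low k ->
  (#|A| <= incidence_rank (up @: A) A)%N.
Proof.
elim: {A}_.+1 {-2}A (ltnSn #|A|) => // m IH A.
have [->|[a0 a0A]] := set_0Vmem A; first by rewrite cards0.
rewrite ltnS => cA Alow.
case: (arg_maxnP phi a0A) => a {a0A a0} a_in phi_max.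
have aA : a \in A := a_in.
have Da : a |: (A :\ a) = A by rewrite setD1K.
have aA' : a \notin A :\ a by rewrite !inE eqxx.
have sub : A :\ a \subset low k by exact: subset_trans (subD1set _ _) Alow.
have cA' : (#|A :\ a| < m)%N by rewrite (cardsD1 a A) aA in cA.
have /setIdP[/setIdP[aX /eqP ca] va] := subsetP Alow a aA.
(* As [phi a] is maximal, [a] is not a face of the upper partner of any other
   set of [A], and its row and column split off. *)
have b0 : mask 'F_2 (up @: (A :\ a)) *m incidence *m mask 'F_2 [set a] = 0.
  apply: mask_block_eq0 => _ t /imsetP[b /setD1P[ba bA] ->] /set1P ->.
  have /setIdP[/setIdP[bX /eqP cb] vb] := subsetP Alow b bA.
  have [uX vu phiu] := toggle_add bX.
  apply/negP => a_up; case: (eqVneq (v a) (v b)) => [vab|].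
    case/eqP: ba; apply/eqP; rewrite eq_sym eqEcard ca cb leqnn andbT.
    apply/subsetP => x xa; have := subsetP a_up x xa.
    by rewrite inE => /orP[/set1P xv|//]; rewrite -vab in xv; rewrite -xv xa in va.
  rewrite -vu => /(toggle_phi uX aX a_up); rewrite phiu ltnNge => /negP[].
  exact: phi_max bA.
have dup : [disjoint up @: (A :\ a) & [set up a]].
  rewrite disjoint_sym -setI_eq0; apply/eqP/setP => s; rewrite !inE.
  apply/negP => /andP[/eqP -> /imsetP[b bA /up_inj]].
  move=> /(_ k (subsetP Alow _ aA) (subsetP sub _ bA)) ab.
  by rewrite -ab in bA; rewrite bA in aA'.
have dA : [disjoint A :\ a & [set a]].
  by rewrite -setI_eq0; apply/eqP/setP => s; rewrite !inE; rewrite andbC; case: eqP.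
have := rank_block_triangular dup dA b0.
rewrite -imset_set1 -imsetU setUC Da.
rewrite -2![\rank _]/(incidence_rank _ _).
have := IH _ cA' sub.
have : (0 < \rank (mask 'F_2 (up @: [set a]) *m incidence
    *m mask 'F_2 [set a]))%N.
  rewrite lt0n mxrank_eq0; apply/eqP.
  move/matrixP/(_ (enum_rank (up a)) (enum_rank a)).
  rewrite mask_block_entry !mxE !enum_rankK imset_set1 !inE !eqxx subsetUr.
  by rewrite !mulr1; apply/eqP; rewrite oner_eq0.
rewrite (cardsD1 a A) aA => pos le1 le2; apply: leq_trans le2.
by rewrite -/(incidence_rank _ _) addnC leq_add.
Qed.

Lemma toggle_acyclic p : betti X p = 0%N.
Proof.
have lowS k : low k \subset simplices_of_card X k.
  by apply/subsetP => s /setIdP[].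
have rk k : (#|low k| <= incidence_rank (simplices_of_card X k.+1)
    (simplices_of_card X k))%N.
  apply: leq_trans (low_rank (subxx _)) (incidence_rank_mono _ (lowS k)).
  apply/subsetP => _ /imsetP[s /setIdP[/setIdP[sX /eqP cs] vs] ->].
  by have [uX _ _] := toggle_add sX; rewrite inE /up uX cardsU1 vs cs add1n eqxx.
have card_le : (#|simplices_of_card X p.+1| <= #|low p.+1| + #|low p|)%N.
  have -> : #|simplices_of_card X p.+1| = (#|low p.+1|
      + #|simplices_of_card X p.+1 :\: low p.+1|)%N.
    by have := cardsDS (lowS p.+1); have := subset_leq_card (lowS p.+1); lia.
  rewrite leq_add2l.
  have upE : {in simplices_of_card X p.+1 :\: low p.+1, forall s,
      [/\ s :\ v s \in low p & up (s :\ v s) = s]}.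
    move=> s /setDP[sXp]; rewrite inE sXp negbK /= => vs.
    have /setIdP[sX /eqP cs] := sXp.
    have [rX vr] := toggle_remove sX vs.
    rewrite /up vr setD1K // !inE rX vr eqxx /=; split=> //.
    by rewrite andbT; have := cardsD1 (v s) s; rewrite vs cs add1n => -[->].
  have down_inj : {in simplices_of_card X p.+1 :\: low p.+1 &,
      injective (fun s => s :\ v s)}.
    by move=> s t /upE[_ us] /upE[_ ut] st; rewrite -us -ut st.
  rewrite -(card_in_imset down_inj).
  by apply/subset_leq_card/subsetP => _ /imsetP[s /upE[sl _] ->].
have := betti_rank_nullity p cX; have := rk p; have := rk p.+1; lia.
Qed.

End Toggle.
End Families.

Lemma betti_imset (T T' : finType) (f : T -> T') (X : {set {set T}}) p :
  injective f -> betti ((fun s : {set T} => f @: s) @: X) p = betti X p.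
Proof.
move=> f_inj; set F := fun s : {set T} => f @: s.
have F_inj : injective F by exact: imset_inj.
have FK s : f @^-1: (F s) = s.
  by apply/setP => x; rewrite inE mem_imset.
have cardF k : simplices_of_card (F @: X) k = F @: simplices_of_card X k.
  apply/setP => s; rewrite inE; apply/andP/imsetP.
    by move=> [/imsetP[t tX ->]]; rewrite card_imset // => ct; exists t; rewrite ?inE ?tX.
  by move=> [t /setIdP[tX ct] ->]; rewrite card_imset // mem_imset.
have subF s t : (F s \subset F t) = (s \subset t).
  apply/idP/idP => [|st]; last exact: imsetS.
  by rewrite -{2}(FK s) -{2}(FK t); exact: preimsetS.
have rkF k : \rank (boundary (F @: X) k) = \rank (boundary X k).
  apply/eqP; rewrite eqn_leq; apply/andP; split.
    apply: (rank_reindex_le (M := fun s t : {set T'} => (t \subset s)%:R)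
      (M' := fun s t : {set T} => (t \subset s)%:R)
      (h := fun s => f @^-1: s) (k := fun s => f @^-1: s)).
    - by move=> s; rewrite cardF => /imsetP[t tX ->]; rewrite FK.
    - by move=> s; rewrite cardF => /imsetP[t tX ->]; rewrite FK.
    - move=> s t; rewrite !cardF => /imsetP[s' _ ->] /imsetP[t' _ ->].
      by rewrite !FK subF.
  apply: (rank_reindex_le (M := fun s t : {set T} => (t \subset s)%:R)
    (M' := fun s t : {set T'} => (t \subset s)%:R) (h := F) (k := F)).
  - by move=> s sX; rewrite cardF imset_f.
  - by move=> s sX; rewrite cardF imset_f.
  - by move=> s t _ _; rewrite subF.
by rewrite /betti !mxrank_ker !rkF cardF card_imset.
Qed.

Section Acyclic.
Variables (T : finType) (C Q : {set {set T}}).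
Hypotheses (cX : convex (C :|: Q)) (dCQ : [disjoint C & Q]) (nCQ : no_face C Q).

Lemma betti_acyclic_quotient p :
  (forall q, betti Q q = 0%N) -> betti C p = betti (C :|: Q) p.
Proof.
move=> Q0; have := betti_total_le cX dCQ nCQ p.
have := betti_sub_le cX dCQ nCQ p; rewrite !Q0; lia.
Qed.

Lemma betti_acyclic_sub p :
  (forall q, betti C q = 0%N) -> betti Q p.+1 = betti (C :|: Q) p.+1.
Proof.
move=> C0; have := betti_total_le cX dCQ nCQ p.+1.
have := betti_quotient_le cX dCQ nCQ p; rewrite !C0; lia.
Qed.

Lemma betti_acyclic_total p :
  (forall q, betti (C :|: Q) q = 0%N) -> betti Q p.+1 = betti C p.
Proof.
move=> X0; have := betti_sub_le cX dCQ nCQ p.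
have := betti_quotient_le cX dCQ nCQ p; rewrite !X0; lia.
Qed.

End Acyclic.

(** * Flags of simplices *)

Section Flags.
Variable K : simplicial_complex.
Implicit Types (c e : {set barycenter K}) (a b : barycenter K).

Lemma barycenter_neq0 a : val a != set0.
Proof. exact: simplices_neq0 (valP a). Qed.

Lemma is_flagP c : reflect
  {in c &, forall a b, (val a \subset val b) || (val b \subset val a)}
  (is_flag c).
Proof.
apply: (iffP forall_inP) => [fc a b ac bc|fc a ac].
  by have /forall_inP := fc a ac; apply.
by apply/forall_inP => b bc; apply: fc.
Qed.

Lemma is_flag_sub c e : e \subset c -> is_flag c -> is_flag e.
Proof.
move=> /subsetP ec /is_flagP fc; apply/is_flagP => a b ae be.
by apply: fc; apply: ec.
Qed.

Lemma is_flag_add b c : is_flag c ->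
  {in c, forall a, (val a \subset val b) || (val b \subset val a)} ->
  is_flag (b |: c).
Proof.
move=> /is_flagP fc bc; apply/is_flagP => a a' /setU1P[->|ac] /setU1P[->|a'c].
- by rewrite subxx.
- by rewrite orbC bc.
- exact: bc.
- exact: fc.
Qed.

Lemma flag_min c : is_flag c -> c != set0 ->
  exists2 a, a \in c & {in c, forall b, val a \subset val b}.
Proof.
move=> /is_flagP fc /set0Pn[a0 a0c].
case: (arg_minnP (fun a => #|val a|) a0c) => a ac a_min; exists a => // b bc.
have /orP[//|ba] := fc a b ac bc.
suff -> : val b = val a by [].
by apply/eqP; rewrite eqEcard ba; exact: a_min.
Qed.

Lemma flag_meet_min c a : a \in c -> {in c, forall b, val a \subset val b} ->
  \bigcap_(b in c) val b = val a.
Proof.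
move=> ac a_min; apply/eqP; rewrite eqEsubset bigcap_inf //=.
by apply/bigcapsP => b bc; exact: a_min.
Qed.

Definition flags_in (X : {set {set vertex K}}) : {set {set barycenter K}} :=
  [set c in Sd_simplices K | [forall a in c, val a \in X]].

Definition subcomplex (X : {set {set vertex K}}) :=
  X \subset simplices K /\
  forall s t : {set vertex K}, s \in X -> t != set0 -> t \subset s -> t \in X.

Section SubdivisionInvariance.
Variable X : {set {set vertex K}}.
Hypothesis sX : subcomplex X.

Let XK s : s \in X -> s \in simplices K.
Proof. by apply: subsetP; case: sX. Qed.

Let Xface s t : s \in X -> t != set0 -> t \subset s -> t \in X.
Proof. by case: sX => _; apply. Qed.

Let point : finType := (barycenter K + vertex K)%type.
Implicit Types z : {set point}.

Let flag z : {set barycenter K} := inl @^-1: z.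
Let base z : {set vertex K} := inr @^-1: z.

Let point_eqE := (inj_eq (@inl_inj (barycenter K) (vertex K)),
  inj_eq (@inr_inj (barycenter K) (vertex K))).

Let flagUl b z : flag (inl b |: z) = b |: flag z.
Proof. by apply/setP => a; rewrite !inE point_eqE. Qed.
Let flagUr x z : flag (inr x |: z) = flag z.
Proof. by apply/setP => a; rewrite !inE. Qed.
Let baseUl b z : base (inl b |: z) = base z.
Proof. by apply/setP => a; rewrite !inE. Qed.
Let baseUr x z : base (inr x |: z) = x |: base z.
Proof. by apply/setP => a; rewrite !inE point_eqE. Qed.
Let flagDr x z : flag (z :\ inr x) = flag z.
Proof. by apply/setP => a; rewrite !inE. Qed.
Let baseDl b z : base (z :\ inl b) = base z.
Proof. by apply/setP => a; rewrite !inE. Qed.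
Let flagS z z' : z \subset z' -> flag z \subset flag z'.
Proof. exact: preimsetS. Qed.
Let baseS z z' : z \subset z' -> base z \subset base z'.
Proof. exact: preimsetS. Qed.

Let z_neq0 z : (z != set0) = (flag z != set0) || (base z != set0).
Proof.
apply/idP/idP => [/set0Pn[[a|x] zi]|/orP[]/set0Pn[a]].
- by apply/orP; left; apply/set0Pn; exists a; rewrite inE.
- by apply/orP; right; apply/set0Pn; exists x; rewrite inE.
- by rewrite inE => za; apply/set0Pn; exists (inl a).
- by rewrite inE => za; apply/set0Pn; exists (inr a).
Qed.

(** A simplicial version of the mapping cylinder of the identity of [X], with the
    subdivision at one end and [X] at the other. *)
Let cylinder : {set {set point}} :=
  [set z | [&& (flag z != set0) || (base z != set0), is_flag (flag z),
    [forall a in flag z, (val a \in X) && (base z \subset val a)]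
    & (base z == set0) || (base z \in X)]].

Let cylinderP z : reflect [/\ (flag z != set0) || (base z != set0),
    is_flag (flag z), {in flag z, forall a, val a \in X},
    {in flag z, forall a, base z \subset val a}
    & base z != set0 -> base z \in X]
  (z \in cylinder).
Proof.
rewrite inE; apply: (iffP and4P) => [[z0 fz /forall_inP az bz]|[z0 fz az az' bz]].
  split=> // [a /az/andP[]//|a /az/andP[]//|b0].
  by rewrite (negbTE b0) in bz.
split=> //; last by case: eqP => //= /eqP.
by apply/forall_inP => a /[dup] /az -> /az' ->.
Qed.

Let cylinder_face z z' : z' \in cylinder -> z \subset z' -> z != set0 ->
  z \in cylinder.
Proof.
move=> /cylinderP[z'0 fz' az' az'' bz'] zz'; rewrite z_neq0 => z0.
have [fs bs] := (flagS zz', baseS zz').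
apply/cylinderP; split=> //.
- exact: is_flag_sub fs fz'.
- by move=> a /(subsetP fs)/az'.
- by move=> a /(subsetP fs)/az''; exact: subset_trans.
- move=> b0; apply: (Xface _ b0 bs); apply: bz'.
  by apply: contraNneq b0 => b'0; rewrite b'0 subset0 in bs.
Qed.

Let convex_filter (P : pred {set point}) :
  (forall z z', z \subset z' -> P z -> P z') ->
  convex [set z in cylinder | P z].
Proof.
move=> PS r s t /setIdP[rM Pr] /setIdP[tM _] rs st.
rewrite inE (PS r) ?andbT //; apply: cylinder_face tM st _.
have : r != set0 by rewrite z_neq0; case/cylinderP: rM.
by apply: contraNneq => s0; rewrite s0 subset0 in rs.
Qed.

Let convex_cylinder : convex cylinder.
Proof.
have := @convex_filter predT (fun _ _ _ => id).
by rewrite setIdE (_ : [set x | _] = setT) ?setIT.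
Qed.

Let neq0S (T : finType) (s t : {set T}) : s \subset t -> s != set0 -> t != set0.
Proof. by move=> st; apply: contraNneq => t0; rewrite t0 subset0 in st. Qed.

Let over_base := [set z in cylinder | base z != set0].
Let over_flag := [set z in cylinder | flag z != set0].

(** For a given base, the flags of the simplices that contain it form a cone, with
    apex the barycenter of the base. *)
Let over_base_acyclic p : betti over_base p = 0%N.
Proof.
have [->|[z0 /setIdP[/cylinderP[_ _ _ _ z0X] z00]]] := set_0Vmem over_base.
  apply/eqP; rewrite -leqn0 -[X in (_ <= X)%N](cards0 {set point}).
  exact: betti_le_card.
(* [b0] is a default value, for the sets [z] whose base is not in [K] *)
pose b0 : barycenter K := Sub (base z0) (XK (z0X z00)).
pose v z : point := inl (insubd b0 (base z)).
have vE z : z \in over_base -> val (insubd b0 (base z)) = base z.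
  by case/setIdP => /cylinderP[_ _ _ _ zX] /zX/XK zK; rewrite insubdK.
apply: (@toggle_acyclic _ _ v (fun z => #|base z|)).
- by apply: convex_filter => z z' /baseS; exact: neq0S.
- move=> z zM; have := vE _ zM; rewrite /v baseUl.
  case/setIdP: zM => /cylinderP[zn zf az az' zX] z0b.
  move: (insubd b0 _) => b bE; split=> //; rewrite inE baseUl z0b andbT.
  apply/cylinderP; rewrite flagUl baseUl z0b orbT; split=> //.
  + by apply: is_flag_add => // a /az'; rewrite bE orbC => ->.
  + by move=> a /setU1P[->|/az//]; rewrite bE zX.
  + by move=> a /setU1P[->|/az'//]; rewrite bE.
  + by move=> _; exact: zX.
- move=> z zM _; rewrite /v baseDl; split=> //.
  case/setIdP: zM => zM z0b; rewrite inE baseDl z0b andbT.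
  by apply: cylinder_face zM (subD1set _ _) _; rewrite z_neq0 baseDl z0b orbT.
- move=> z z' _ _ /baseS zz' vzz'; rewrite ltnNge.
  apply: contra vzz' => czz'; rewrite /v.
  by have /eqP -> : base z' == base z by rewrite eqEcard zz'.
Qed.

(** For a given flag, the subsets of its smallest element form a cone, with apex any
    vertex of that element. *)
Let over_flag_acyclic p : betti over_flag p = 0%N.
Proof.
have [->|[z0 /setIdP[/cylinderP[_ _ _ _ z0X] /set0Pn[a0 _]]]] :=
  set_0Vmem over_flag.
  apply/eqP; rewrite -leqn0 -[X in (_ <= X)%N](cards0 {set point}).
  exact: betti_le_card.
have /set0Pn[x0 _] := barycenter_neq0 a0.
pose w (c : {set barycenter K}) : vertex K :=
  odflt x0 [pick x in \bigcap_(b in c) val b].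
pose v z : point := inr (w (flag z)).
have wP z a : z \in over_flag -> a \in flag z -> w (flag z) \in val a.
  case/setIdP => /cylinderP[_ zf _ _ _] z0' az.
  have [m mz m_min] := flag_min zf z0'.
  rewrite /w (flag_meet_min mz m_min); case: pickP => [x xm|m0] /=.
    exact: subsetP (m_min a az) x xm.
  by have /set0Pn[x] := barycenter_neq0 m; rewrite m0.
apply: (@toggle_acyclic _ _ v (fun z => #|flag z|)).
- by apply: convex_filter => z z' /flagS; exact: neq0S.
- move=> z zM; rewrite /v flagUr; split=> //; rewrite inE flagUr.
  have wz := fun a => @wP z a zM; move: (w _) wz => x xz.
  case/setIdP: zM => /cylinderP[zn zf az az' zX] z0f; rewrite z0f andbT.
  have xzS a : a \in flag z -> x |: base z \subset val a.
    by move=> za; rewrite subUset sub1set xz // az'.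
  apply/cylinderP; rewrite flagUr baseUr z0f; split=> // b0.
  by have /set0Pn[a za] := z0f; apply: Xface (az a za) b0 (xzS a za).
- move=> z zM _; rewrite /v flagDr; split=> //.
  case/setIdP: zM => zM z0f; rewrite inE flagDr z0f andbT.
  by apply: cylinder_face zM (subD1set _ _) _; rewrite z_neq0 flagDr z0f.
- move=> z z' _ _ /flagS zz' vzz'; rewrite ltnNge.
  apply: contra vzz' => czz'; rewrite /v.
  by have /eqP -> : flag z' == flag z by rewrite eqEcard zz'.
Qed.

Let split_cylinder (P : pred {set point}) :
  (forall z z', z \subset z' -> P z -> P z') ->
  (forall p, betti [set z in cylinder | P z] p = 0%N) ->
  forall p, betti [set z in cylinder | ~~ P z] p = betti cylinder p.
Proof.
move=> PS P0 p.
have E : cylinder = [set z in cylinder | ~~ P z] :|: [set z in cylinder | P z].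
  by apply/setP => z; rewrite !inE -andb_orr orNb andbT.
rewrite [RHS](_ : _ = betti ([set z in cylinder | ~~ P z]
  :|: [set z in cylinder | P z]) p); last by rewrite -E.
apply: betti_acyclic_quotient => //.
- by rewrite -E.
- by rewrite -setI_eq0; apply/eqP/setP => z; rewrite !inE;
    case: (P z); rewrite ?andbF.
- move=> s t /setIdP[_ nPs] /setIdP[_ Pt].
  by apply: contra nPs => ts; exact: PS Pt.
Qed.

(** The cylinder has the homology of either end, since what remains of it without
    that end is acyclic. *)
Theorem betti_flags_in p : betti (flags_in X) p = betti X p.
Proof.
transitivity (betti cylinder p).
  rewrite -(split_cylinder _ over_base_acyclic); last first.
    by move=> z z' /baseS; exact: neq0S.
  rewrite -(betti_imset _ p (@inl_inj (barycenter K) (vertex K))).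
  congr (betti _ p); apply/setP => z; rewrite inE negbK.
  apply/imsetP/andP => [[c /setIdP[/setIdP[c0 fc] /forall_inP cX] ->]|[]].
    have fl : flag [set inl x | x in c] = c.
      by apply/setP => a; rewrite inE mem_imset //; exact: inl_inj.
    have ba : base [set inl x | x in c] = set0.
      by apply/setP => x; rewrite !inE; apply/imsetP => -[].
    split; last by rewrite ba.
    by apply/cylinderP; rewrite fl ba c0 eqxx; split=> // a _; rewrite sub0set.
  move=> /cylinderP[z0 zf az _ _] /eqP b0; exists (flag z).
    rewrite b0 eqxx orbF in z0; rewrite inE inE z0 zf.
    by apply/forall_inP.
  apply/setP => -[a|x]; first by rewrite mem_imset ?inE //; exact: inl_inj.
  have := in_set0 x; rewrite -b0 inE => ->.
  by apply/esym/imsetP => -[].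
rewrite -(split_cylinder _ over_flag_acyclic); last first.
  by move=> z z' /flagS; exact: neq0S.
rewrite -[RHS](betti_imset _ p (@inr_inj (barycenter K) (vertex K))).
congr (betti _ p); apply/setP => z; rewrite inE negbK.
apply/andP/imsetP => [[]|[s sX' ->]].
  move=> /cylinderP[z0 zf az _ zX] /eqP f0; exists (base z).
    by apply: zX; rewrite f0 eqxx in z0.
  apply/setP => -[a|x]; last by rewrite mem_imset ?inE //; exact: inr_inj.
  have := in_set0 a; rewrite -f0 inE => ->.
  by apply/esym/imsetP => -[].
have fl : flag [set inr x | x in s] = set0.
  by apply/setP => x; rewrite !inE; apply/imsetP => -[].
have ba : base [set inr x | x in s] = s.
  by apply/setP => a; rewrite inE mem_imset //; exact: inr_inj.
split; last by rewrite fl.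
apply/cylinderP; rewrite fl ba eqxx /=; split=> //.
- by have := simplices_neq0 (XK sX').
- by apply/is_flagP => a b; rewrite inE.
- by move=> a; rewrite inE.
- by move=> a; rewrite inE.
Qed.

End SubdivisionInvariance.
End Flags.

(** * The hypersurface of a cochain *)

Section Hypersurface.
Variables (K : simplicial_complex) (eps : cochain0 K).
Implicit Types (c e : {set barycenter K}) (a : barycenter K).

Lemma constant_onP (s : {set vertex K}) :
  reflect {in s &, forall x y, eps x = eps y} (constant_on eps s).
Proof.
apply: (iffP forall_inP) => [cs x y xs ys|cs x xs].
  by have /forall_inP/(_ y ys)/eqP := cs x xs.
by apply/forall_inP => y ys; apply/eqP/cs.
Qed.

Lemma constant_onS (s t : {set vertex K}) :
  t \subset s -> constant_on eps s -> constant_on eps t.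
Proof.
move=> /subsetP ts /constant_onP cs; apply/constant_onP => x y xt yt.
by apply: cs; apply: ts.
Qed.

Let mixed a := ~~ constant_on eps (val a).

(** If the smallest element of a flag is not constant, it contains an edge that is not
    constant, and this edge extends the flag downwards. *)
Lemma mem_V c : (c \in V eps) = (c \in Sd_simplices K) && [forall a in c, mixed a].
Proof.
apply/bigcupP/andP => [[s /andP[_ ns] /setIdP[cSd /exists_inP[e _]]]|].
  case/and3P => /subsetP ce _ /forall_inP se; split=> //.
  apply/forall_inP => a /ce/se sa; apply: contra ns; exact: constant_onS.
case=> /[dup] cSd /setIdP[c0 fc] /forall_inP cmix.
have [m mc m_min] := flag_min fc c0.
have /forall_inPn[x xm /forall_inPn[y ym xy]] := cmix m mc.
have sm : [set x; y] \subset val m by rewrite subUset !sub1set xm ym.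
have s0 : [set x; y] != set0 by apply/set0Pn; exists x; rewrite set21.
have sK := simplices_face (valP m) s0 sm.
pose s : barycenter K := Sub [set x; y] sK.
exists s.
  have nxy : x != y by apply: contraNneq xy => ->.
  rewrite /= cards2 nxy /=; apply/constant_onP => /(_ x y).
  by rewrite set21 set22 => /(_ isT isT)/eqP; rewrite (negbTE xy).
have sc : {in c, forall a, val s \subset val a}.
  by move=> a /m_min; exact: subset_trans.
rewrite inE cSd; apply/exists_inP; exists (s |: c).
  rewrite inE is_flag_add // ?andbT; first by apply/set0Pn; exists s; rewrite setU11.
  by move=> a /sc ->; rewrite orbT.
rewrite subsetUr setU11 /=; apply/forall_inP => a /setU1P[->|/sc//].
exact: subxx.
Qed.

Lemma subcomplex_K0 : subcomplex (K0 eps).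
Proof.
split; first by apply/subsetP => s /setIdP[].
move=> s t /setIdP[sK cs] t0 ts; rewrite inE (simplices_face sK) //=.
exact: constant_onS cs.
Qed.

(** The chains of [meeting_V] are those of [Sd K] relative to the subdivided [K0]. *)
Definition meeting_V := [set c in Sd_simplices K | [exists a in c, mixed a]].

Definition on_side (b : 'F_2) (s : {set vertex K}) := [forall x in s, eps x == b].

(** In a flag of [meeting_V] the constant simplices come below the other ones; being
    nested, they all lie on the same side of [V]. So the two sides cover
    [meeting_V], and they meet in [V]. *)
Definition side b := [set c in meeting_V |
  [forall a in c, mixed a || on_side b (val a)]].

Lemma convex_flags (P : pred {set barycenter K}) :
  (forall c e, e \in Sd_simplices K -> P c -> c \subset e -> P e) ->
  convex [set c in Sd_simplices K | P c].
Proof.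
move=> PS r s t /setIdP[rSd Pr] /setIdP[tSd _] rs st.
have s0 : s != set0.
  apply: contraNneq (Sd_simplices_neq0 rSd) => s0.
  by rewrite s0 subset0 in rs.
have sSd := Sd_simplices_face tSd s0 st.
by rewrite inE sSd (PS r).
Qed.

Let mixedS c e : c \subset e ->
  [exists a in c, mixed a] -> [exists a in e, mixed a].
Proof.
by move=> /subsetP ce /exists_inP[a /ce ae na]; apply/exists_inP; exists a.
Qed.

Lemma convex_meeting_V : convex meeting_V.
Proof. by apply: convex_flags => c e _ Pc /mixedS; apply. Qed.

Lemma side_face b c e : c \in side b -> e \in meeting_V -> e \subset c ->
  e \in side b.
Proof.
move=> /setIdP[_ /forall_inP cb] eM /subsetP ec; rewrite inE eM.
by apply/forall_inP => a /ec/cb.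
Qed.

Lemma convex_side b : convex (side b).
Proof.
move=> r s t rS tS rs st; apply: (side_face tS) => //.
by apply: convex_meeting_V rs st; [case/setIdP: rS|case/setIdP: tS].
Qed.

Let mixed_sub a a' : val a \subset val a' -> mixed a -> mixed a'.
Proof. by move=> ab; apply: contra; exact: constant_onS. Qed.

Let F2_neq (b x y : 'F_2) : x != b -> y != b -> x = y.
Proof.
by case: b x y => [[|[|//]] ?] [[|[|//]] ?] [[|[|//]] ?] // _ _; apply: val_inj.
Qed.

Let mixed_side b a : mixed a -> exists2 x, x \in val a & eps x = b.
Proof.
move=> na; have [/exists_inP[x xa /eqP xb]|/exists_inPn no] :=
  boolP [exists x in val a, eps x == b]; first by exists x.
case/negP: na; apply/constant_onP => x y xa ya.
by apply: (@F2_neq b); apply: no.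
Qed.

(** Given the nonconstant elements of the flag, its constant elements range over a
    cone: the apex is the face on the side [b] of the smallest nonconstant element,
    which contains all the constant elements. *)
Lemma side_acyclic b p : betti (side b) p = 0%N.
Proof.
have [->|[c0 /setIdP[/setIdP[_ /exists_inP[a0 _ _]] _]]] :=
  set_0Vmem (side b).
  apply/eqP; rewrite -leqn0 -[X in (_ <= X)%N](cards0 {set barycenter K}).
  exact: betti_le_card.
pose N c := [set a in c | mixed a].
pose u (c : {set barycenter K}) :=
  [set x in \bigcap_(a in c) val a | eps x == b].
pose v c : barycenter K := insubd a0 (u (N c)).
have NS c e : c \subset e -> N c \subset N e.
  by move=> /subsetP ce; apply/subsetP => a /setIdP[/ce ae na]; rewrite inE ae.
have NP c : c \in side b ->
    exists2 m, m \in N c & \bigcap_(a in N c) val a = val m.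
  move=> /setIdP[/setIdP[/setIdP[_ fc] /exists_inP[a ac na]] _].
  have [| |m mN m_min] := @flag_min _ (N c).
  - by apply: is_flag_sub fc; apply/subsetP => e /setIdP[].
  - by apply/set0Pn; exists a; rewrite inE ac.
  by exists m => //; exact: flag_meet_min.
have vE c : c \in side b -> val (v c) = u (N c).
  move=> cS; have [m /setIdP[mc nm] mE] := NP c cS.
  rewrite insubdK //; apply: simplices_face (valP m) _ _.
    have [x xm xb] := mixed_side b nm.
    by apply/set0Pn; exists x; rewrite inE mE xm xb eqxx.
  by apply/subsetP => x; rewrite inE mE => /andP[].
have v_side c : c \in side b -> on_side b (val (v c)).
  by move=> cS; rewrite vE //; apply/forall_inP => x /setIdP[].
have on_sideN a : on_side b (val a) -> ~~ mixed a.
  move=> /forall_inP ab; rewrite negbK; apply/constant_onP => x y xa ya.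
  by rewrite (eqP (ab x xa)) (eqP (ab y ya)).
have NU c : c \in side b -> N (v c |: c) = N c.
  move=> /v_side/on_sideN/negbTE nv; apply/setP => a; rewrite !inE andb_orl.
  by case: eqP => [->|] //=; rewrite nv andbF.
have ND c : c \in side b -> N (c :\ v c) = N c.
  move=> /v_side/on_sideN/negbTE nv; apply/setP => a; rewrite !inE.
  by case: eqP => [->|] //=; rewrite nv andbF.
apply: (@toggle_acyclic _ _ v (fun c => #|N c|)).
- exact: convex_side.
- move=> c cS; rewrite NU // {2}/v NU // -/(v c); split=> //.
  have /setIdP[/setIdP[/setIdP[c0' fc] mc] /forall_inP cb] := cS.
  have [m mN mE] := NP c cS; have /setIdP[m_c nm] := mN.
  rewrite !inE (mixedS (subsetUr _ _)) // andbT; apply/andP; split.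
    apply/andP; split; first by apply/set0Pn; exists (v c); rewrite setU11.
    apply: is_flag_add => // a ac; rewrite vE //.
    have [na|nna] := boolP (mixed a).
      apply/orP; right; apply/subsetP => x /setIdP[/bigcapP/(_ a)].
      by rewrite inE ac na => /(_ isT).
    have /orP[na|/forall_inP ab] := cb a ac; first by rewrite na in nna.
    have am : val a \subset val m.
      have /is_flagP/(_ a m ac m_c)/orP[//|ma] := fc.
      by rewrite (mixed_sub ma nm) in nna.
    by apply/orP; left; apply/subsetP => x xa; rewrite inE mE (subsetP am) // ab.
  apply/forall_inP => a /setU1P[->|/cb//].
  by rewrite v_side ?orbT.
- move=> c cS _; rewrite /v ND // -/(v c); split=> //.
  have /setIdP[/setIdP[cSd mc] _] := cS.
  have [m mN _] := NP c cS; rewrite -ND // in mN; have /setIdP[m_c nm] := mN.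
  apply: side_face cS _ (subD1set _ _).
  rewrite inE; apply/andP; split; last by apply/exists_inP; exists m.
  by apply: Sd_simplices_face cSd _ (subD1set _ _); apply/set0Pn; exists m.
- move=> c e _ _ /NS ec vec; rewrite ltnNge; apply: contra vec => cec.
  by rewrite /v; have /eqP -> : N e == N c by rewrite eqEcard ec.
Qed.

Lemma V_sub_side b : V eps \subset side b.
Proof.
apply/subsetP => c; rewrite mem_V => /andP[/[dup] cSd /setIdP[c0 _]].
move=> /forall_inP cm; rewrite inE; apply/andP; split.
  have /set0Pn[a ac] := c0; rewrite inE cSd.
  by apply/exists_inP; exists a => //; exact: cm.
by apply/forall_inP => a /cm ->.
Qed.

Let Q := side 1 :\: V eps.

Let V_face c e : c \in V eps -> e \in side 1 -> e \subset c -> e \in V eps.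
Proof.
rewrite !mem_V => /andP[_ /forall_inP cm] /setIdP[/setIdP[-> _] _] /subsetP ec.
by apply/forall_inP => a /ec/cm.
Qed.

Let sideI c : c \in side 0 -> c \in side 1 -> c \in V eps.
Proof.
move=> /setIdP[/setIdP[cSd _] /forall_inP c0] /setIdP[_ /forall_inP c1].
rewrite mem_V cSd; apply/forall_inP => a ac.
have /orP[//|/forall_inP a0] := c0 a ac.
have /orP[//|/forall_inP a1] := c1 a ac.
have /set0Pn[x xa] := barycenter_neq0 a.
by have := a0 x xa; rewrite (eqP (a1 x xa)) oner_eq0.
Qed.

Let meeting_VE : meeting_V = side 0 :|: Q.
Proof.
apply/setP => c; rewrite in_setU [c \in Q]in_setD.
apply/idP/orP => [cM|[/setIdP[]//|/andP[_ /setIdP[]//]]].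
have [cV|ncV] := boolP (c \in V eps); first by left; exact: (subsetP (V_sub_side 0)).
have /setIdP[cSd /exists_inP[m mc nm]] := cM; have /setIdP[_ fc] := cSd.
move: ncV; rewrite mem_V cSd => /forall_inPn[a ac]; rewrite negbK => ca.
have /set0Pn[x xa] := barycenter_neq0 a.
have cb : c \in side (eps x).
  rewrite inE cM; apply/forall_inP => a' a'c.
  rewrite /mixed; have [ca'|//] := boolP (constant_on eps (val a')).
  apply/forall_inP => y ya'; apply/eqP.
  have /is_flagP/(_ a a' ac a'c)/orP[aa'|a'a] := fc.
    by have /constant_onP := ca'; apply=> //; exact: (subsetP aa').
  by have /constant_onP := ca; apply=> //; exact: (subsetP a'a).
have [x0|x0] := eqVneq (eps x) 0; first by left; rewrite -x0.
by right; rewrite -(@F2_neq 0 (eps x) 1 x0 _).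
Qed.

(** As both sides are acyclic, the Mayer-Vietoris sequence of their union
    [meeting_V] and of their intersection [V] is a shift of degrees. *)
Lemma betti_V p : betti (V eps) p = betti meeting_V p.+1.
Proof.
have sideE : side 1 = V eps :|: Q.
  by rewrite /Q setDE setUIr setUCr setIT; apply/esym/setUidPr/V_sub_side.
have dV : [disjoint V eps & Q] by rewrite disjoints_subset /Q setDE setCI setCK subsetUr.
have nV : no_face (V eps) Q.
  move=> c e cV /setDP[eS neV]; apply: contra neV => ec; exact: V_face ec.
have <- : betti Q p.+1 = betti (V eps) p.
  apply: betti_acyclic_total => //; rewrite -sideE; last exact: side_acyclic.
  exact: convex_side.
rewrite meeting_VE; apply: betti_acyclic_sub.
- by rewrite -meeting_VE; exact: convex_meeting_V.
- rewrite -setI_eq0; apply/eqP/setP => c; rewrite in_setI [c \in Q]in_setD in_set0.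
  by apply/negP => /and3P[c0 /negP nV' c1]; apply: nV'; exact: sideI.
- move=> c e cS /setDP[eS neV]; apply: contra neV => ec.
  apply: sideI => //; apply: side_face cS _ ec; by case/setIdP: eS.
- exact: side_acyclic.
Qed.

Let Sd_simplicesE : Sd_simplices K = flags_in (K0 eps) :|: meeting_V.
Proof.
apply/setP => c; rewrite !inE -andb_orr; case: (_ && _) => //=.
apply/esym; have [//|] := boolP [forall a in c, val a \in K0 eps].
move=> /forall_inPn[a ac]; rewrite inE (valP a) => na.
by apply/exists_inP; exists a.
Qed.

Let disjoint_meeting_V : [disjoint flags_in (K0 eps) & meeting_V].
Proof.
rewrite -setI_eq0; apply/eqP/setP => c; rewrite !inE.
apply/negP => /andP[/andP[_ /forall_inP ck] /andP[_ /exists_inP[a ac na]]].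
by case/negP: na; have /setIdP[] := ck a ac.
Qed.

Let no_face_meeting_V : no_face (flags_in (K0 eps)) meeting_V.
Proof.
move=> c e /setIdP[_ /forall_inP ck] /setIdP[_ /exists_inP[a ae na]].
by apply: contra na => /subsetP/(_ a ae)/ck/setIdP[].
Qed.

Let convex_Sd : convex (flags_in (K0 eps) :|: meeting_V).
Proof.
rewrite -Sd_simplicesE => r s t rSd tSd rs st; apply: Sd_simplices_face tSd _ st.
by apply: contraNneq (Sd_simplices_neq0 rSd) => s0; rewrite s0 subset0 in rs.
Qed.

Lemma betti_Sd p : betti (Sd_simplices K) p = betti (simplices K) p.
Proof.
rewrite -betti_flags_in; first congr (betti _ p).
  apply/setP => c; rewrite [RHS]inE; apply/esym/andb_idr => _.
  by apply/forall_inP => a _; exact: valP.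
split=> // s t sK t0 ts; exact: simplices_face ts.
Qed.

Lemma betti_K0_le p :
  (betti (K0 eps) p <= betti (simplices K) p + betti (V eps) p)%N.
Proof.
rewrite betti_V -betti_Sd -(betti_flags_in subcomplex_K0) Sd_simplicesE.
exact: betti_sub_le.
Qed.

Lemma betti_V_le p :
  (betti (V eps) p <= betti (simplices K) p.+1 + betti (K0 eps) p)%N.
Proof.
rewrite betti_V -betti_Sd -(betti_flags_in subcomplex_K0) Sd_simplicesE.
exact: betti_quotient_le.
Qed.

End Hypersurface.

Local Open Scope nat_scope.

(** * Counting flags *)

Section Support.
Variable K : simplicial_complex.
Implicit Types (c e : {set barycenter K}) (a b : barycenter K).

Definition support c : {set vertex K} := \bigcup_(a in c) val a.

Lemma supportS c e : c \subset e -> support c \subset support e.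
Proof.
move=> /subsetP ce; apply/bigcupsP => a /ce ae; exact: bigcup_sup.
Qed.

Lemma support_max c : is_flag c -> c != set0 ->
  exists2 a, a \in c & support c = val a.
Proof.
move=> /is_flagP fc /set0Pn[a0 a0c].
case: (arg_maxnP (fun a => #|val a|) a0c) => a ac a_max; exists a => //.
apply/eqP; rewrite eqEsubset (bigcup_sup a) // andbT.
apply/bigcupsP => b bc; have /orP[//|ab] := fc b a bc ac.
suff -> : val b = val a by [].
by apply/esym/eqP; rewrite eqEcard ab; exact: a_max.
Qed.

Lemma support_simplex c : c \in Sd_simplices K -> support c \in simplices K.
Proof.
by case/setIdP => c0 fc; have [a _ ->] := support_max fc c0; exact: valP.
Qed.

Lemma card_flag_le c : is_flag c -> #|c| <= #|support c|.
Proof.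
move=> /is_flagP fc; rewrite cardE -(size_map (fun a => #|val a|)).
rewrite -(size_iota 1 #|support c|); apply: uniq_leq_size.
  rewrite map_inj_in_uniq ?enum_uniq // => a b; rewrite !mem_enum => ac bc cab.
  apply/val_inj/eqP; have /orP[ab|ba] := fc a b ac bc.
    by rewrite eqEcard ab cab /=.
  by rewrite eq_sym eqEcard ba cab /=.
move=> k /mapP[a]; rewrite mem_enum => ac ->; rewrite mem_iota.
rewrite card_gt0 barycenter_neq0 add1n ltnS.
by apply: subset_leq_card; exact: bigcup_sup.
Qed.

Definition full_flags (s : {set vertex K}) := [set c : {set barycenter K} |
  [&& is_flag c, support c == s & #|c| == #|s|]].

(** A full flag gains one vertex at each step, so it amounts to an ordering of the
    vertices of [s]. The induction removes [s] itself from the flag. *)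
Lemma card_full_flags s : (s == set0) || (s \in simplices K) ->
  #|full_flags s| = #|s|`!.
Proof.
move Em : #|s| => m; elim: m s Em => [|m IH] s cs.
  have -> : s = set0 by apply: cards0_eq.
  move=> _; rewrite fact0; apply/eqP/cards1P; exists set0.
  apply/setP => c; rewrite !inE cards0 cards_eq0; apply/and3P/idP => [[]//|/eqP ->].
  split=> //; first by apply/is_flagP => a b; rewrite inE.
  by rewrite /support big_set0.
have s0 : s != set0 by apply: contra_eq_neq cs => ->; rewrite cards0.
rewrite (negbTE s0) /= => sK; pose b : barycenter K := Sub s sK.
have max_in c : is_flag c -> c != set0 -> support c = s -> b \in c.
  move=> fc c0 cs'; have [a ac] := support_max fc c0.
  by rewrite cs' => sa; have -> : b = a by exact: val_inj.
have cs_pos c : #|c| = m.+1 -> c != set0.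
  by move=> cc; rewrite -card_gt0 cc.
have remove c : c \in full_flags s ->
    [/\ b \in c, c :\ b \in full_flags (support (c :\ b))
      & exists2 x, x \in s & support (c :\ b) = s :\ x].
  rewrite inE cs => /and3P[fc /eqP cs' /eqP cc].
  have bc := max_in c fc (cs_pos c cc) cs'.
  have fe : is_flag (c :\ b) by exact: is_flag_sub (subD1set _ _) fc.
  have ce : #|c :\ b| = m by have := cardsD1 b c; rewrite bc cc add1n => -[].
  have es : support (c :\ b) \subset s by rewrite -cs' supportS // subD1set.
  have ne : support (c :\ b) != s.
    apply/eqP => se; have e0 : c :\ b != set0.
      by apply: contraNneq s0 => e0; rewrite -se e0 /support big_set0.
    by have := max_in _ fe e0 se; rewrite !inE eqxx.
  have /properP[_ [x xs nx]] : support (c :\ b) \proper s.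
    by rewrite properEneq ne es.
  have exs : support (c :\ b) = s :\ x.
    apply/eqP; rewrite eqEcard subsetD1 es nx /=.
    have := cardsD1 x s; rewrite xs cs add1n => -[<-].
    by rewrite -ce; exact: card_flag_le.
  split=> //; last by exists x.
  rewrite inE fe eqxx /= ce exs eq_sym.
  by have := cardsD1 x s; rewrite xs cs add1n => -[->].
have fiber x : x \in s ->
    #|[set c in full_flags s | support (c :\ b) == s :\ x]| = m`!.
  move=> xs; have cx : #|s :\ x| = m.
    by have := cardsD1 x s; rewrite xs cs add1n => -[].
  rewrite -(IH (s :\ x)) //; last first.
    have [//|x0] := eqVneq (s :\ x) set0.
    by rewrite (simplices_face sK) // subD1set.
  rewrite -(card_in_imset (f := fun c => c :\ b)); last first.
    move=> c e /setIdP[/remove[bc _ _] _] /setIdP[/remove[be _ _] _] ce.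
    by rewrite -(setD1K bc) -(setD1K be) ce.
  congr #|pred_of_set _|; apply/setP => e; apply/imsetP/idP.
    by move=> [c /setIdP[/remove[_ ce _] /eqP <-] ->].
  rewrite inE cx => /and3P[fe /eqP es /eqP ce].
  have be : b \notin e.
    apply: contraTN xs => be; have : x \notin support e by rewrite es !inE eqxx.
    by apply: contraNN => xs; apply/bigcupP; exists b.
  exists (b |: e); last by rewrite setU1K.
  rewrite inE setU1K // es eqxx andbT inE cs cardsU1 be ce eqxx andbT.
  apply/andP; split.
    apply: is_flag_add => // a ae; apply/orP; left.
    apply: subset_trans (subD1set s x); rewrite -es; exact: bigcup_sup.
  rewrite /support bigcup_setU big_set1 -/(support e) es.
  by apply/eqP/setUidPl; exact: subD1set.
rewrite factS -cs -sum_nat_const.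
transitivity (\sum_(x in s) #|[set c in full_flags s | support (c :\ b) == s :\ x]|);
  last exact: eq_bigr.
under [RHS]eq_bigr => x _ do rewrite -sum1_card.
rewrite -sum1_card (exchange_big_dep (mem (full_flags s))) /=; last first.
  by move=> x c _ /setIdP[].
apply: eq_bigr => c cF; have [_ _ [x xs cx]] := remove c cF.
rewrite (big_pred1 x) // => y; rewrite in_set cF /= cx.
apply/andP/eqP => [[ys /eqP/setP/(_ y)]|->]; last by split.
by rewrite !inE ys !andbT eqxx => /negbFE/eqP.
Qed.

Lemma card_flags_le (s : {set vertex K}) :
  #|[set c : {set barycenter K} | support c == s]| <= 2 ^ (2 ^ #|s|).
Proof.
rewrite -(card_powerset s) -(card_powerset (powerset s)).
have inj : injective (fun c : {set barycenter K} => val @: c).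
  by apply: imset_inj; exact: val_inj.
rewrite -(card_imset [set c | support c == s] inj).
apply/subset_leq_card/subsetP => _ /imsetP[c /[!inE] /eqP cs ->].
apply/subsetP => _ /imsetP[a ac ->].
by rewrite powersetE -cs; exact: bigcup_sup.
Qed.

Definition dim_lt (n : nat) :=
  forall s : {set vertex K}, s \in simplices K -> #|s| <= n.

Lemma f_vector_Sd n : dim_lt n.+1 ->
  f_vector (Sd K) n = n.+1`! * f_vector K n.
Proof.
move=> Kn; rewrite /f_vector -sum1_card mulnC -sum_nat_const.
rewrite (partition_big support (mem (simplices_of_card (simplices K) n.+1))) /=.
  apply: eq_bigr => s /setIdP[sK /eqP cs].
  rewrite -[in RHS]cs -card_full_flags ?sK ?orbT // -sum1_card.
  apply: eq_bigl => c; rewrite !inE cs.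
  case: (eqVneq #|c| n.+1) => [cc|]; rewrite ?andbF //.
  have -> : c != set0 by rewrite -card_gt0 cc.
  by rewrite !andbT.
move=> c /setIdP[cSd /eqP cc]; rewrite inE support_simplex //=.
rewrite eqn_leq Kn ?support_simplex //= -cc; apply: card_flag_le.
by case/setIdP: cSd.
Qed.

(** There are at most [2 ^ (2 ^ n)] flags that are not full, and [B] is so large that
    together they weigh no more than half of one full flag. *)
Lemma flag_weight n (s : {set vertex K}) (B := 2 * 2 ^ (2 ^ n)) :
  s \in simplices K -> #|s| <= n ->
  2 * \sum_(c in Sd_simplices K | support c == s) B ^ #|c|
    <= (2 * n`! + 1) * B ^ #|s|.
Proof.
move=> sK sn; rewrite (bigID (fun c : {set barycenter K} => #|c| == #|s|)) /=.
have s_pos : 0 < #|s| by rewrite card_gt0 simplices_neq0.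
have full : \sum_(c in Sd_simplices K | (support c == s) && (#|c| == #|s|)) B ^ #|c|
    <= n`! * B ^ #|s|.
  rewrite (eq_bigl (fun c => c \in full_flags s)); last first.
    move=> c; rewrite !inE; case: (eqVneq #|c| #|s|) => [cc|]; rewrite ?andbF //.
    by rewrite -card_gt0 cc s_pos andbA.
  rewrite (eq_bigr (fun _ => B ^ #|s|)); last first.
    by move=> c; rewrite inE => /and3P[_ _ /eqP ->].
  rewrite sum_nat_const card_full_flags ?sK ?orbT // leq_mul2r.
  by rewrite leq_fact ?orbT.
have rest : 2 * \sum_(c in Sd_simplices K | (support c == s) && (#|c| != #|s|)) B ^ #|c|
    <= B ^ #|s|.
  have -> : B ^ #|s| = 2 * (2 ^ (2 ^ n) * B ^ #|s|.-1).
    by rewrite mulnA -/B -expnS prednK.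
  rewrite leq_mul2l /=.
  apply: (@leq_trans (\sum_(c in [set c : {set barycenter K} | support c == s])
      B ^ #|s|.-1)).
    rewrite big_mkcond [X in _ <= X]big_mkcond; apply: leq_sum => c _.
    rewrite inE; case: ifP => // /andP[cSd /andP[sc cc]]; rewrite sc.
    apply: leq_pexp2l; first by rewrite /B muln_gt0 expn_gt0.
    have /setIdP[_ /card_flag_le] := cSd; rewrite (eqP sc) => cs.
    by rewrite -ltnS prednK // ltn_neqAle cc.
  rewrite sum_nat_const leq_mul2r; apply/orP; right.
  apply: leq_trans (card_flags_le _) _.
  by rewrite leq_exp2l // leq_exp2l.
move: full rest; under eq_bigl do rewrite andbA.
under [X in _ -> 2 * X <= _ -> _]eq_bigl do rewrite andbA.
rewrite mulnDr mulnDl mul1n => full rest; apply: leq_add rest.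
by rewrite -mulnA leq_mul2l full.
Qed.

End Support.

(** * Iterated subdivisions *)

(** The smallest simplex of [K] that contains a given simplex of its [d]-th
    subdivision. *)
Fixpoint carrier (K : simplicial_complex) (d : nat) :
    {set vertex (iter d Sd K)} -> {set vertex K} :=
  if d is d'.+1
  then fun c : {set barycenter (iter d' Sd K)} => carrier (support c)
  else id.

Section Carrier.
Variable K : simplicial_complex.

Lemma carrierS d (s t : {set vertex (iter d Sd K)}) :
  s \subset t -> carrier s \subset carrier t.
Proof. by elim: d s t => //= d IH s t /supportS; exact: IH. Qed.

Lemma carrier_simplex d (s : {set vertex (iter d Sd K)}) :
  s \in simplices (iter d Sd K) ->
  (carrier s \in simplices K) * (#|s| <= #|carrier s|).
Proof.
elim: d s => //= d IH c cSd; have [cK cc] := IH _ (support_simplex cSd).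
split=> //; apply: leq_trans cc; apply: card_flag_le.
by case/setIdP: cSd.
Qed.

Definition skeleton_card n d :=
  #|[set s in simplices (iter d Sd K) | #|carrier s| <= n]|.

(** A subdivision multiplies the total weight of the simplices by at most [n`! + 1/2],
    for the weights of [flag_weight]. *)
Lemma skeleton_card_le n d :
  2 ^ d * skeleton_card n d <= (2 * n`! + 1) ^ d
    * \sum_(s in simplices K | #|s| <= n) (2 * 2 ^ (2 ^ n)) ^ #|s|.
Proof.
set B := 2 * 2 ^ (2 ^ n).
pose weight d := \sum_(s in simplices (iter d Sd K) | #|carrier s| <= n) B ^ #|s|.
have weight_rec e : 2 * weight e.+1 <= (2 * n`! + 1) * weight e.
  rewrite /weight /= (partition_big (@support _)
    (fun s => (s \in simplices (iter e Sd K)) && (#|carrier s| <= n))) /=; last first.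
    by move=> c /andP[cSd ->]; rewrite support_simplex.
  rewrite big_distrr [X in _ <= X]big_distrr /=; apply: leq_sum => s /andP[sK sn].
  have [_ cs] := carrier_simplex sK.
  apply: leq_trans (flag_weight sK (leq_trans cs sn)).
  rewrite leq_mul2l /= leq_eqVlt; apply/orP; left; apply/eqP/eq_bigl => c.
  by case: eqP => [->|]; rewrite ?andbF // sn andbT.
have : 2 ^ d * weight d <= (2 * n`! + 1) ^ d * weight 0.
  elim: d => // d IH; rewrite !expnSr -!mulnA.
  apply: (@leq_trans (2 ^ d * ((2 * n`! + 1) * weight d))).
    by rewrite leq_mul2l weight_rec orbT.
  by rewrite mulnCA [X in _ <= X]mulnCA leq_mul2l IH orbT.
apply: leq_trans; rewrite leq_mul2l; apply/orP; right.
rewrite /skeleton_card /weight -sum1_card.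
under eq_bigl do rewrite inE.
by apply: leq_sum => s _; rewrite expn_gt0 /B muln_gt0 expn_gt0.
Qed.

End Carrier.

(** * Localization *)

Lemma betti_partition (T : finType) (I : eqType) (g : {set T} -> I)
    (X : {set {set T}}) (r : seq I) p :
  convex X ->
  (forall s t, s \in X -> t \in X -> t \subset s -> g t = g s) -> uniq r ->
  betti [set s in X | g s \in r] p = \sum_(i <- r) betti [set s in X | g s == i] p.
Proof.
move=> cX gX.
have sub (P : pred I) : convex [set s in X | P (g s)].
  move=> r' s t /setIdP[rX Pr] /setIdP[tX Pt] rs st.
  have sX := cX _ _ _ rX tX rs st.
  by rewrite inE sX (gX t s tX sX st) Pt.
have nf (P P' : pred I) : (forall i, P i -> ~~ P' i) ->
    no_face [set s in X | P (g s)] [set s in X | P' (g s)].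
  move=> PP' s t /setIdP[sX Ps] /setIdP[tX Pt]; apply: contraL Pt => ts.
  by rewrite (gX s t) // PP'.
elim: r => [|i r IH] /=.
  rewrite big_nil => _; apply/eqP; rewrite -leqn0; apply: leq_trans (betti_le_card _ _) _.
  by rewrite (_ : [set s in X | _] = set0) ?cards0 //; apply/setP => s; rewrite !inE andbF.
move=> /andP[ir ur]; rewrite big_cons -IH // -betti_disjoint_union.
- by congr (betti _ p); apply/setP => s; rewrite !inE -andb_orr.
- rewrite (_ : _ :|: _ = [set s in X | g s \in i :: r]); first exact: sub (mem (i :: r)).
  by apply/setP => s; rewrite !inE -andb_orr.
- rewrite -setI_eq0; apply/eqP/setP => s; rewrite !inE.
  by case: (eqVneq (g s) i) => [->|]; rewrite ?(negbTE ir) ?andbF.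
- by apply: (nf (pred1 i) (mem r)) => j /= /eqP ->.
- by apply: (nf (mem r) (pred1 i)) => j /= jr; apply: contraNneq ir => <-.
Qed.

Section Localization.
Variable K : simplicial_complex.

Definition piece d (eps : cochain0 (iter d Sd K)) (s : {set vertex K}) :
    {set {set vertex (iter d.+1 Sd K)}} :=
  [set c in V eps | carrier (c : {set vertex (iter d.+1 Sd K)}) == s].

Lemma V_face (L : simplicial_complex) (eps : cochain0 L) c e :
  c \in V eps -> e != set0 -> e \subset c -> e \in V eps.
Proof.
rewrite !mem_V => /andP[cSd /forall_inP cm] e0 /[dup] ec /subsetP sub.
rewrite (Sd_simplices_face cSd e0 ec).
by apply/forall_inP => a /sub/cm.
Qed.

Lemma convex_V (L : simplicial_complex) (eps : cochain0 L) : convex (V eps).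
Proof.
move=> r s t rV tV rs st; apply: V_face tV _ st.
have : r != set0 by move: rV; rewrite mem_V => /andP[/Sd_simplices_neq0].
by apply: contraNneq => s0; rewrite s0 subset0 in rs.
Qed.

(** Without the simplices carried by the [n.-1]-skeleton, what remains of [V] is the
    disjoint union of the pieces: a face of a simplex in the interior of an
    [n]-simplex is either in the same interior or in the skeleton. *)
Lemma betti_V_pieces n d (eps : cochain0 (iter d Sd K)) p : dim_lt K n.+1 ->
  betti (V eps) p <= \sum_(s in simplices_of_card (simplices K) n.+1)
      betti (piece eps s) p + skeleton_card K n d.+1
  /\ \sum_(s in simplices_of_card (simplices K) n.+1) betti (piece eps s) p
    <= betti (V eps) p + skeleton_card K n d.+1.
Proof.
move=> Kn; pose car (c : {set vertex (iter d.+1 Sd K)}) := carrier c.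
pose C := [set c in V eps | #|car c| <= n].
pose Q := [set c in V eps | n < #|car c|].
have VSd c : c \in V eps -> c \in simplices (iter d.+1 Sd K).
  by rewrite mem_V => /andP[].
have VE : V eps = C :|: Q.
  by apply/setP => c; rewrite !inE -andb_orr ltnNge orbN andbT.
have cX : convex (C :|: Q) by rewrite -VE; exact: convex_V.
have dCQ : [disjoint C & Q].
  rewrite -setI_eq0; apply/eqP/setP => c; rewrite !inE ltnNge.
  by case: (_ <= n); rewrite ?andbF.
have nCQ : no_face C Q.
  move=> c e /setIdP[_ cn] /setIdP[_ en]; apply: contraL en => ec.
  by rewrite -leqNgt; apply: leq_trans cn; apply/subset_leq_card/carrierS.
have CSk : #|C| <= skeleton_card K n d.+1.
  apply/subset_leq_card/subsetP => c /setIdP[/VSd cSd cn].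
  by rewrite inE cSd.
have QK c : c \in Q -> car c \in simplices_of_card (simplices K) n.+1.
  move=> /setIdP[/VSd cSd cn]; have [cK _] := carrier_simplex cSd.
  by rewrite inE cK eqn_leq Kn.
have <- : betti Q p = \sum_(s in simplices_of_card (simplices K) n.+1)
    betti (piece eps s) p.
  transitivity (\sum_(s <- enum (simplices_of_card (simplices K) n.+1))
      betti [set c in Q | car c == s] p).
    rewrite -betti_partition ?enum_uniq //.
    - congr (betti _ p); apply/setP => c; rewrite [RHS]inE mem_enum.
      by apply/esym/andb_idr/QK.
    - exact: convex_quotient nCQ.
    - move=> c e /QK/setIdP[_ /eqP cc] /QK/setIdP[_ /eqP ce] ec; apply/eqP.
      by rewrite eqEcard carrierS //= cc ce.
  rewrite big_enum /=; apply: eq_bigr => s /setIdP[_ /eqP cs].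
  congr (betti _ p); apply/setP => c; rewrite !inE.
  by case: eqP => [->|]; rewrite ?andbF // cs ltnSn !andbT.
have := betti_total_le cX dCQ nCQ p; have := betti_quotient_le_card cX dCQ nCQ p.
have := betti_le_card C p; rewrite -VE; lia.
Qed.

End Localization.

Section Embeddings.

(** The image is a full subcomplex, so that embeddings can be subdivided. *)
Record embedding (K' K : simplicial_complex) := Embedding {
  emb :> vertex K' -> vertex K;
  emb_inj : injective emb;
  emb_simplex : forall s : {set vertex K'},
    (emb @: s \in simplices K) = (s \in simplices K')
}.

Section SdEmbedding.
Variables (K' K : simplicial_complex) (j : embedding K' K).

Lemma emb_barycenter (a : barycenter K') : j @: val a \in simplices K.
Proof. by rewrite emb_simplex (valP a). Qed.

Definition Sd_fun (a : barycenter K') : barycenter K :=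
  Sub (j @: val a) (emb_barycenter a).

Lemma Sd_fun_inj : injective Sd_fun.
Proof.
move=> a b /(congr1 val)/= ab; apply: val_inj.
by apply: (imset_inj (@emb_inj _ _ j)).
Qed.

Lemma emb_imsetS (s t : {set vertex K'}) : (j @: s \subset j @: t) = (s \subset t).
Proof.
apply/subsetP/subsetP => [st x xs|st _ /imsetP[x /st xt ->]]; last exact: imset_f.
by have := st (j x) (imset_f _ xs); rewrite mem_imset //; exact: emb_inj.
Qed.

Lemma Sd_fun_simplex (c : {set barycenter K'}) :
  (Sd_fun @: c \in Sd_simplices K) = (c \in Sd_simplices K').
Proof.
rewrite !inE -!card_gt0 card_imset; last exact: Sd_fun_inj.
congr (_ && _); apply/is_flagP/is_flagP => fc.
  move=> a b ac bc; rewrite -!emb_imsetS.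
  exact: fc (imset_f Sd_fun ac) (imset_f Sd_fun bc).
move=> _ _ /imsetP[a ac ->] /imsetP[b bc ->] /=; rewrite !emb_imsetS.
exact: fc.
Qed.

Definition Sd_emb : embedding (Sd K') (Sd K) :=
  @Embedding (Sd K') (Sd K) Sd_fun Sd_fun_inj Sd_fun_simplex.

Lemma support_emb (c : {set barycenter K'}) :
  support (Sd_emb @: c) = j @: support c.
Proof.
apply/setP => x; apply/bigcupP/imsetP.
  move=> [_ /imsetP[a ac ->] /imsetP[y ya ->]]; exists y => //.
  by apply/bigcupP; exists a.
move=> [y /bigcupP[a ac ya] ->]; exists (Sd_fun a); first exact: imset_f.
exact: imset_f.
Qed.

End SdEmbedding.

Fixpoint iter_emb (K' K : simplicial_complex) (j : embedding K' K) d :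
    embedding (iter d Sd K') (iter d Sd K) :=
  if d is d'.+1 then Sd_emb (iter_emb j d') else j.

Variables (K' K : simplicial_complex) (j : embedding K' K).

Lemma carrier_emb d (s : {set vertex (iter d Sd K')}) :
  carrier (iter_emb j d @: s) = j @: carrier s.
Proof. by elim: d s => //= d IH s; rewrite support_emb IH. Qed.

Lemma iter_emb_image d (s : {set vertex (iter d Sd K)}) :
  s \in simplices (iter d Sd K) -> carrier s \subset j @: setT ->
  exists t : {set vertex (iter d Sd K')}, s = iter_emb j d @: t.
Proof.
suff sub e (u : {set vertex (iter e Sd K)}) : u \in simplices (iter e Sd K) ->
    carrier u \subset j @: setT -> u \subset iter_emb j e @: setT.
  move=> sK sj; exists ([set x | iter_emb j d x \in s]); apply/setP => x.
  apply/idP/imsetP => [xs|[y]]; last by rewrite inE => ys ->.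
  have /imsetP[y _ xy] := subsetP (sub d s sK sj) x xs.
  by exists y => //; rewrite inE -xy.
elim: e u => //= e IH c cSd cj.
have sub_j := IH _ (support_simplex cSd) cj.
apply/subsetP => a ac; set f := iter_emb j e.
have aE : f @: ([set x | f x \in val a]) = val a.
  apply/setP => x; apply/imsetP/idP => [[y]|xa]; first by rewrite inE => ya ->.
  have : x \in support c by apply/bigcupP; exists a.
  move=> /(subsetP sub_j)/imsetP[y _ xy]; exists y => //.
  by rewrite inE -xy.
have a'K : [set x | f x \in val a] \in simplices (iter e Sd K') by rewrite -(emb_simplex f) aE (valP a).
have -> : a = Sd_fun f (Sub [set x | f x \in val a] a'K).
  by apply: val_inj; exact/esym.
exact: imset_f.
Qed.

Definition pullback d (eps : cochain0 (iter d Sd K)) : cochain0 (iter d Sd K') :=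
  [ffun x => eps (iter_emb j d x)].

Lemma constant_on_pullback d (eps : cochain0 (iter d Sd K)) s :
  constant_on (pullback eps) s = constant_on eps (iter_emb j d @: s).
Proof.
apply/constant_onP/constant_onP => cs.
  move=> _ _ /imsetP[x xs ->] /imsetP[y ys ->].
  by have := cs x y xs ys; rewrite !ffunE.
by move=> x y xs ys; rewrite !ffunE; apply: cs; exact: imset_f.
Qed.

Lemma mem_piece d (eps : cochain0 (iter d Sd K))
    (c : {set vertex (iter d.+1 Sd K')}) :
  (iter_emb j d.+1 @: c \in piece eps (j @: setT))
    = (c \in piece (pullback eps) setT).
Proof.
rewrite !inE carrier_emb (inj_eq (imset_inj (@emb_inj _ _ j))); congr (_ && _).
rewrite !mem_V; congr (_ && _); first exact: (emb_simplex (iter_emb j d.+1) c).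
apply/forall_inP/forall_inP => cm.
  move=> a ac; have := cm _ (imset_f _ ac).
  by rewrite constant_on_pullback.
by move=> _ /imsetP[a ac ->]; have := cm a ac; rewrite constant_on_pullback.
Qed.

Lemma betti_piece_emb d (eps : cochain0 (iter d Sd K)) p :
  betti (piece eps (j @: setT)) p = betti (piece (pullback eps) setT) p.
Proof.
rewrite -[RHS](betti_imset _ p (@emb_inj _ _ (iter_emb j d.+1))).
congr (betti _ p); apply/setP => c; apply/idP/imsetP.
  move=> /setIdP[cV /eqP cj].
  have cSd : c \in simplices (iter d.+1 Sd K) by move: cV; rewrite mem_V => /andP[].
  have [|e ce] := iter_emb_image cSd; first by rewrite cj.
  by exists e => //; rewrite -mem_piece -ce inE cV cj eqxx.
by move=> [e eP ->]; rewrite mem_piece.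
Qed.
End Embeddings.

Local Open Scope ring_scope.

Section StandardSimplex.
Variable n : nat.

Definition std_simplices : {set {set 'I_n.+1}} := [set~ set0].

Lemma std_simplices_neq0 s : s \in std_simplices -> s != set0.
Proof. by rewrite !inE. Qed.

Lemma std_simplices_face (s t : {set 'I_n.+1}) :
  s \in std_simplices -> t != set0 -> t \subset s -> t \in std_simplices.
Proof. by rewrite !inE. Qed.

Lemma std_simplices_vertex (v : 'I_n.+1) : [set v] \in std_simplices.
Proof. by rewrite !inE; apply/set0Pn; exists v; rewrite inE. Qed.

Definition std_simplex : simplicial_complex :=
  SimplicialComplex std_simplices_neq0 std_simplices_face std_simplices_vertex.

Lemma embedding_of_simplex (K : simplicial_complex) (s : {set vertex K}) :
  s \in simplices_of_card (simplices K) n.+1 ->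
  exists j : embedding std_simplex K, j @: setT = s.
Proof.
move=> /setIdP[sK /eqP cs].
pose f (i : vertex std_simplex) : vertex K := enum_val (cast_ord (esym cs) i).
have f_inj : injective f by move=> i k /enum_val_inj/cast_ord_inj.
have f_simplex (t : {set vertex std_simplex}) :
    (f @: t \in simplices K) = (t \in simplices std_simplex).
  rewrite [in RHS]inE /= in_set1; apply/idP/idP => [/simplices_neq0|t0].
    by apply: contraNneq => ->; rewrite imset0.
  apply: (simplices_face sK); first by rewrite -card_gt0 card_imset // card_gt0.
  by apply/subsetP => _ /imsetP[i _ ->]; exact: enum_valP.
exists (Embedding f_inj f_simplex); apply/eqP; rewrite eqEcard /=.
rewrite card_imset // cardsT card_ord cs leqnn andbT.
by apply/subsetP => _ /imsetP[i _ ->]; exact: enum_valP.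
Qed.

End StandardSimplex.

(** Under a product measure, the restriction of a function to a subset is
    distributed according to the product measure on this subset. *)
Lemma sum_marginal (R : comNzRingType) (S T T' : finType) (w : S -> R)
    (f : T' -> T) (G : {ffun T' -> S} -> R) :
  \sum_x w x = 1 -> injective f ->
  \sum_(g : {ffun T -> S}) G [ffun x => g (f x)] * \prod_v w (g v)
    = \sum_(h : {ffun T' -> S}) G h * \prod_u w (h u).
Proof.
move=> w1 f_inj; pose res (g : {ffun T -> S}) := [ffun x => g (f x)].
rewrite (partition_big res predT) //=; apply: eq_bigr => h _.
rewrite (eq_bigr (fun g : {ffun T -> S} => G h * \prod_v w (g v))); last first.
  by move=> g /eqP <-.
rewrite -big_distrr /=; congr (_ * _).
pose Q v : pred S := fun x => [forall u, (f u == v) ==> (x == h u)].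
rewrite (eq_bigl (fun g => g \in family Q)); last first.
  move=> g; apply/eqP/familyP => [gh v|gQ].
    by apply/forallP => u; apply/implyP => /eqP <-; rewrite -gh ffunE.
  apply/ffunP => u; rewrite ffunE; apply/eqP.
  by have /forallP/(_ u) := gQ (f u); rewrite eqxx.
rewrite -(bigA_distr_big_dep Q (fun _ => w)) (bigID (mem (f @: setT))) /= mulrC big1 ?mul1r.
  rewrite big_imset /=; last by move=> u u' _ _; exact: f_inj.
  rewrite (eq_bigl predT) => [|u]; last by rewrite inE.
  apply: eq_bigr => u _; rewrite (big_pred1 (h u)) // => x /=.
  apply/forallP/eqP => [/(_ u)|-> u']; first by rewrite eqxx => /eqP.
  by apply/implyP => /eqP/f_inj ->.
move=> v /imsetP vf; rewrite -[RHS]w1; apply: eq_bigl => x.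
apply/forallP => u; apply/implyP => /eqP fu; case: vf.
by exists u.
Qed.

From mathcomp Require Import all_classical all_reals all_analysis.
From mathcomp Require Import lra ring.
Import Order.TTheory GRing.Theory Num.Theory.
Import numFieldNormedType.Exports.
Local Open Scope ring_scope.

(** * Expectations *)

Section Expectations.
Variables (R : realType) (nu : R).
Hypothesis nu01 : 0 <= nu <= 1.

Let weight (x : 'F_2) : R := if x == 0 then nu else 1 - nu.

Let weight_ge0 x : 0 <= weight x.
Proof. by rewrite /weight; case: ifP => _; move: nu01; lra. Qed.

Let sum_weight : \sum_x weight x = 1.
Proof. by rewrite !big_ord_recl big_ord0 /weight /= addr0 addrC subrK. Qed.

Lemma mu_ge0 K (eps : cochain0 K) : 0 <= Defs.mu nu eps.
Proof. by apply: prodr_ge0 => v _; exact: weight_ge0. Qed.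

Lemma sum_mu K : \sum_(eps : cochain0 K) Defs.mu nu eps = 1.
Proof.
have <- : \prod_(v : vertex K) \sum_x weight x = 1 by rewrite big1.
by rewrite bigA_distr_bigA.
Qed.

Lemma expectation_le K (X Y : cochain0 K -> R) :
  (forall eps, X eps <= Y eps) -> Defs.expectation nu X <= Defs.expectation nu Y.
Proof.
by move=> XY; apply: ler_sum => eps _; rewrite ler_wpM2r ?mu_ge0.
Qed.

Lemma expectationD K (X Y : cochain0 K -> R) :
  Defs.expectation nu (fun eps => X eps + Y eps) = Defs.expectation nu X + Defs.expectation nu Y.
Proof. by rewrite -big_split; apply: eq_bigr => eps _; rewrite mulrDl. Qed.

Lemma expectation_cst K (a : R) : Defs.expectation nu (fun _ : cochain0 K => a) = a.
Proof. by rewrite /Defs.expectation -big_distrr /= sum_mu mulr1. Qed.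

Lemma expectation_sum K (I : finType) (P : pred I) (X : I -> cochain0 K -> R) :
  Defs.expectation nu (fun eps => \sum_(i | P i) X i eps)
    = \sum_(i | P i) Defs.expectation nu (X i).
Proof.
rewrite exchange_big /=; apply: eq_bigr => eps _.
by rewrite big_distrl.
Qed.

Lemma expectation_pullback (K' K : simplicial_complex) (j : embedding K' K) d
    (X : cochain0 (iter d Sd K') -> R) :
  Defs.expectation nu (fun eps => X (pullback j eps)) = Defs.expectation nu X.
Proof. exact: (sum_marginal X sum_weight (@emb_inj _ _ (iter_emb j d))). Qed.

Lemma E_betti_K0_V K p :
  E_betti_K0 nu p K <= (betti (simplices K) p)%:R + E_betti_V nu p K /\
  E_betti_V nu p K <= (betti (simplices K) p.+1)%:R + E_betti_K0 nu p K.
Proof.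
rewrite -[X in _ <= X + _ /\ _](expectation_cst K).
rewrite -[X in _ /\ _ <= X + _](expectation_cst K) -!expectationD.
split; apply: expectation_le => eps; rewrite -natrD ler_nat.
  exact: betti_K0_le.
exact: betti_V_le.
Qed.

(** What each open [n]-simplex of a complex contributes to the expectation. *)
Definition E_betti_interior p n d : R :=
  Defs.expectation nu (fun eps : cochain0 (iter d Sd (std_simplex n)) =>
    (betti (piece eps finset.setT) p)%:R).

Lemma E_betti_V_interior n p d K : dim_lt K n.+1 ->
  `|E_betti_V nu p (iter d Sd K) - (f_vector K n)%:R * E_betti_interior p n d|
    <= (skeleton_card K n d.+1)%:R.
Proof.
move=> Kn.
have E_pieces : Defs.expectation nu (fun eps : cochain0 (iter d Sd K) =>
    \sum_(s in simplices_of_card (simplices K) n.+1) (betti (piece eps s) p)%:R)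
    = (f_vector K n)%:R * E_betti_interior p n d.
  rewrite expectation_sum mulr_natl -sumr_const; apply: eq_bigr => s sK.
  have [j <-] := embedding_of_simplex sK.
  rewrite /E_betti_interior -(expectation_pullback j); apply: eq_bigr => eps _.
  by rewrite betti_piece_emb.
have cst := expectation_cst (iter d Sd K) (skeleton_card K n d.+1)%:R.
have le1 : E_betti_V nu p (iter d Sd K) <=
    (f_vector K n)%:R * E_betti_interior p n d + (skeleton_card K n d.+1)%:R.
  rewrite -E_pieces -cst -expectationD; apply: expectation_le => eps.
  rewrite -natr_sum -natrD ler_nat.
  by case: (betti_V_pieces eps p Kn).
have le2 : (f_vector K n)%:R * E_betti_interior p n d <=
    E_betti_V nu p (iter d Sd K) + (skeleton_card K n d.+1)%:R.
  rewrite -E_pieces -cst -expectationD; apply: expectation_le => eps.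
  rewrite -natr_sum -natrD ler_nat.
  by case: (betti_V_pieces eps p Kn).
by rewrite ler_norml; apply/andP; split; lra.
Qed.
End Expectations.

(** * The limit *)

Lemma cvg_geometric_increments (R : realType) (u : nat -> R) (C q : R) :
  0 <= q < 1 -> (forall d, `|u d.+1 - u d| <= C * q ^+ d) -> cvgn u.
Proof.
move=> /andP[q0 q1] uq.
have C0 : 0 <= C by have := le_trans (normr_ge0 _) (uq 0%N); rewrite mulr1.
have : cvgn (series (telescope u)).
  apply: (@normed_cvg _ R^o); apply: (@series_le_cvg _ _ (geometric C q)) => //=.
  - by move=> d; rewrite mulr_ge0 ?exprn_ge0.
  - by apply: is_cvg_geometric_series; rewrite ger0_norm.
rewrite telescopeK => cu.
rewrite (_ : u = (fun d => u d - u 0%N) \+ cst (u 0%N)).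
  by apply: is_cvgD => //; exact: is_cvg_cst.
by apply/funext => d /=; rewrite subrK.
Qed.

Lemma cvg0_geometric_bound (R : realType) (u : nat -> R) (C q : R) :
  0 <= q < 1 -> (forall d, `|u d| <= C * q ^+ d) -> (u @ \oo --> 0)%classic.
Proof.
move=> /andP[q0 q1] uq; apply/norm_cvg0P.
apply: (@squeeze_cvgr _ _ _ _ (cst 0) (geometric C q)).
- by near=> d; rewrite /= normr_ge0 uq.
- exact: cvg_cst.
- by apply: cvg_geometric; rewrite ger0_norm.
Unshelve. all: by end_near. Qed.

Lemma dim_lt_Sd n K : dim_lt K n -> dim_lt (Sd K) n.
Proof.
move=> Kn c cSd; apply: leq_trans (Kn _ (support_simplex cSd)).
by apply: card_flag_le; case/setIdP: cSd.
Qed.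

Lemma dimension_simplices K n : dimension K = n -> (0 < n)%N ->
  dim_lt K n.+1 /\ (0 < f_vector K n)%N.
Proof.
move=> Kn n0; split.
  move=> s sK; rewrite -Kn; apply: leq_trans (leqSpred _) _.
  by rewrite ltnS; exact: (@leq_bigmax_cond _ _ (fun s : {set vertex K} => #|s|.-1)).
have [s sK sn] : exists2 s, s \in simplices K & n = #|s|.-1.
  have [|s sK sn] := @eq_bigmax_cond _ (mem (simplices K)) (fun s => #|s|.-1).
    2: by exists s => //; rewrite -sn.
  rewrite lt0n; apply/eqP => /card0_eq K0; move: n0; rewrite -Kn /dimension.
  by rewrite big_pred0 // => s; exact: K0.
rewrite card_gt0; apply/set0Pn; exists s; rewrite inE sK /=.
by rewrite sn prednK // card_gt0 simplices_neq0.
Qed.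

Section Limit.
Variables (R : realType) (nu : R).
Hypothesis nu01 : 0 <= nu <= 1.
Variables (p n : nat).
Hypothesis n_gt0 : (0 < n)%N.

Let N : R := (n.+1)`!%:R.

(** The growth rate of the subdivided skeleton. All that matters is that it is less
    than that of the number of [n]-simplices, which is [N]. *)
Let lam : R := n`!%:R + 2^-1.
Let q := lam / N.

Let N_gt0 : 0 < N.
Proof. by rewrite ltr0n fact_gt0. Qed.

Let lam_lt : lam < N.
Proof.
have f1 : 1 <= n`!%:R :> R by rewrite ler1n fact_gt0.
have n1 : 1 <= n%:R :> R by rewrite ler1n.
rewrite /lam /N factS natrM -(addn1 n) natrD.
have : n`!%:R <= n%:R * n`!%:R :> R by rewrite ler_peMl // ler0n.
by rewrite mulrDl mul1r; lra.
Qed.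

Let q01 : 0 <= q < 1.
Proof.
have f1 : 1 <= n`!%:R :> R by rewrite ler1n fact_gt0.
rewrite /q divr_ge0 ?(ltW N_gt0) //=; last by rewrite /lam; lra.
by rewrite ltr_pdivrMr // mul1r.
Qed.

Let skeleton_bound K : exists C, forall d, (skeleton_card K n d)%:R <= C * lam ^+ d.
Proof.
exists (\sum_(s in simplices K | #|s| <= n) (2 * 2 ^ (2 ^ n)) ^ #|s|)%N%:R => d.
rewrite -(ler_pM2l (exprn_gt0 d (ltr0n R 2))) [X in _ <= X]mulrCA.
rewrite -exprMn [X in _ <= X]mulrC.
have -> : 2 * lam = (2 * n`! + 1)%:R.
  by rewrite natrD natrM /lam mulrDr divff // pnatr_eq0.
by rewrite -!natrX -!natrM ler_nat; exact: skeleton_card_le.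
Qed.

Let interior := E_betti_interior nu p n.

Lemma E_betti_V_asymptotics K : dim_lt K n.+1 -> exists C, forall d,
  `|E_betti_V nu p (iter d Sd K) - (f_vector K n)%:R * interior d| <= C * lam ^+ d.
Proof.
move=> Kn; have [C HC] := skeleton_bound K; exists (C * lam) => d.
rewrite -mulrA -exprS; apply: le_trans (HC d.+1).
exact: E_betti_V_interior.
Qed.

(** The [d.+1]-th subdivision of [K] is the [d]-th subdivision of [Sd K], so its
    expectation has two asymptotic expressions. *)
Lemma interior_increment K : dim_lt K n.+1 -> (0 < f_vector K n)%N ->
  exists C, forall d, `|interior d.+1 - N * interior d| <= C * lam ^+ d.
Proof.
move=> Kn; rewrite -(ltr0n R); set f : R := _%:R => f_gt0.
have [C HC] := E_betti_V_asymptotics Kn.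
have [C' HC'] := E_betti_V_asymptotics (dim_lt_Sd Kn).
exists ((C * lam + C') / f) => d.
rewrite mulrAC ler_pdivlMr //.
rewrite -(gtr0_norm f_gt0) -normrM.
have := HC' d; rewrite f_vector_Sd // natrM -/N -/f -iterSr.
have := HC d.+1; rewrite exprS mulrA -/f.
move: (E_betti_V _ _ _) => E; rewrite [(_ + _) * lam ^+ d]mulrDl => le1 le2.
have -> : (interior d.+1 - N * interior d) * f
    = (E - N * f * interior d) - (E - f * interior d.+1) by ring.
by apply: le_trans (ler_normB _ _) _; rewrite addrC lerD.
Qed.

Let limit_at K := fun e : R =>
  (E_betti_V nu p (iter d Sd K) / ((f_vector K n)%:R * N ^+ d) @[d --> \oo] --> e)%classic.

Lemma E_betti_V_limit_exists K : dim_lt K n.+1 -> (0 < f_vector K n)%N ->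
  exists e, forall K', dimension K' = n -> limit_at K' e.
Proof.
move=> Kn f_gt0; have [C HC] := interior_increment Kn f_gt0.
pose z d := interior d / N ^+ d.
have cz : cvgn z.
  apply: (@cvg_geometric_increments _ _ (C / N) q) => // d.
  have Nd : 0 < N ^+ d.+1 by exact: exprn_gt0.
  have -> : z d.+1 - z d = (interior d.+1 - N * interior d) / N ^+ d.+1.
    rewrite mulrBl /z; congr (_ - _); rewrite exprS invfM mulrACA divff ?mul1r //.
    by rewrite gt_eqF.
  rewrite normrM normfV (gtr0_norm Nd) ler_pdivrMr //.
  have -> : C / N * q ^+ d * N ^+ d.+1 = C * lam ^+ d; last exact: HC.
  by rewrite /q exprMn exprVn exprS; field; rewrite expf_neq0 ?gt_eqF.
exists (limn z) => K' K'n; have [K'n1 f'] := dimension_simplices K'n n_gt0.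
rewrite -(ltr0n R) in f'; set f : R := _%:R in f'.
have [D HD] := E_betti_V_asymptotics K'n1.
pose a d := E_betti_V nu p (iter d Sd K') / (f * N ^+ d).
rewrite /limit_at -/a -/f.
rewrite (_ : a = (fun d => a d - z d) \+ z); last first.
  by apply/funext => d /=; rewrite subrK.
rewrite -[limn z]add0r; apply: cvgD => //.
apply: (@cvg0_geometric_bound _ _ (D / f) q) => // d.
have Nd : 0 < f * N ^+ d by rewrite mulr_gt0 // exprn_gt0.
have -> : a d - z d
    = (E_betti_V nu p (iter d Sd K') - f * interior d) / (f * N ^+ d).
  by rewrite /a /z; field; rewrite expf_neq0 ?gt_eqF.
rewrite normrM normfV (gtr0_norm Nd) ler_pdivrMr //.
have -> : D / f * q ^+ d * (f * N ^+ d) = D * lam ^+ d; last exact: HD.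
by rewrite /q exprMn exprVn; field; rewrite expf_neq0 ?gt_eqF.
Qed.

Lemma betti_iter_Sd K d r : betti (simplices (iter d Sd K)) r = betti (simplices K) r.
Proof. by elim: d => //= d IH; rewrite betti_Sd. Qed.

Lemma E_betti_K0_limit K e : (0 < f_vector K n)%N -> limit_at K e ->
  (E_betti_K0 nu p (iter d Sd K) / ((f_vector K n)%:R * N ^+ d) @[d --> \oo] --> e)%classic.
Proof.
rewrite -(ltr0n R); set f : R := _%:R => f_gt0 limV.
pose b := (betti (simplices K) p + betti (simplices K) p.+1)%:R : R.
pose r d := (E_betti_K0 nu p (iter d Sd K) - E_betti_V nu p (iter d Sd K)) / (f * N ^+ d).
rewrite (_ : (fun d => _) = r \+ fun d => E_betti_V nu p (iter d Sd K) / (f * N ^+ d));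
  last by apply/funext => d; rewrite /r /= mulrBl subrK.
rewrite -[e]add0r; apply: cvgD limV.
have N1 : 0 <= N^-1 < 1.
  rewrite invr_ge0 (ltW N_gt0) /= invf_lt1 // /N ltr1n factS.
  by apply: leq_trans (leq_pmulr _ (fact_gt0 n)); rewrite ltnS.
apply: (@cvg0_geometric_bound _ _ (b / f) N^-1) => // d.
have Nd : 0 < f * N ^+ d by rewrite mulr_gt0 // exprn_gt0.
rewrite normrM normfV (gtr0_norm Nd) ler_pdivrMr //.
have -> : b / f * N^-1 ^+ d * (f * N ^+ d) = b.
  by rewrite exprVn; field; rewrite expf_neq0 ?gt_eqF.
have [] := E_betti_K0_V nu01 (iter d Sd K) p; rewrite !betti_iter_Sd.
have := ler0n R (betti (simplices K) p); have := ler0n R (betti (simplices K) p.+1).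
rewrite /b natrD ler_norml => b1 b2 le1 le2.
by apply/andP; split; lra.
Qed.

End Limit.

Theorem corollary1p5 (R : realType) (n : nat) (n_gt0 : (0 < n)%N)
    (K : simplicial_complex) (dimK : dimension K = n)
    (p : nat) (p_lt_n : (p < n)%N) (nu : R) (nu01 : 0 <= nu <= 1) :
  (E_betti_K0 nu p K - (betti (simplices K) p)%:R <= E_betti_V nu p K
     <= E_betti_K0 nu p K + (betti (simplices K) p.+1)%:R)
  /\ (E_betti_K0 nu p (iter d Sd K) / ((f_vector K n)%:R * (n.+1)`!%:R ^+ d)
        @[d --> \oo] --> e_limit nu p n)%classic.
Proof.
split.
  have [le1 le2] := E_betti_K0_V nu01 K p.
  by rewrite lerBlDr addrC le1 addrC.
have [Kn f_gt0] := dimension_simplices dimK n_gt0.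
apply: E_betti_K0_limit => //.
by have /getPex := E_betti_V_limit_exists nu01 p n_gt0 Kn f_gt0; apply.
Qed.
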